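(* Let $K$ be a positive integer and let $\gamma_0,\dots,\gamma_K$ be real numbers with $\gamma_0=1$ and $\gamma_K\neq 0$. Let $\hat{\mathcal H}_n(x)=H_n(x)/(2^nn!)$ for $n\ge 0$ and $\hat{\mathcal H}_n=0$ for $n<0$, and for $n\ge 0$ put $$q_n(x)=\sum_{j=0}^K\gamma_j\hat{\mathcal H}_{n-j}(x).$$ Let $P(x)=\sum_{j=0}^K\gamma_jx^{K-j}$ and let $N^{\mathrm{nr}}$ be the number of non-real zeros of $P$ (counted with multiplicity). Then: (1) $q_n$ has only real zeros for all $n\ge 0$ if and only if $N^{\mathrm{nr}}=0$; moreover, in that case the zeros of $q_n$ are simple and the zeros of $q_{n+1}$ interlace the zeros of $q_n$. (2) If $N^{\mathrm{nr}}>0$, then there exists a nonnegative integer $n_0$ (taken to be the smallest such) such that $q_{n_0}$ has exactly $N^{\mathrm{nr}}$ non-real zeros. Moreover, $q_n$ has exactly $n-N^{\mathrm{nr}}$ real zeros and $N^{\mathrm{nr}}$ non-real zeros if and only if $n\ge n_0$, in which case the real zeros are simple and the real zeros of $q_{n+1}$ interlace the real zeros of $q_n$.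
   Context: $H_n$ denotes the standard (physicists') Hermite polynomial of degree $n$ (orthogonal with respect to $e^{-x^2}$, leading coefficient $2^n$). With this normalization $q_n'=q_{n-1}$. Interlacing: given two finite sets $U,V$ of real numbers, $U$ (strictly) interlaces $V$ if $\min U<\min V$ and between any two consecutive elements of either of the two sets there is an element of the other; ''the zeros of $p$ interlace the zeros of $q$'' means the corresponding sets of zeros satisfy this. *)

(* Defs.v *)
From HB Require Import structures.
From mathcomp Require Import all_boot all_order all_algebra.
From mathcomp Require Import reals.
From mathcomp Require Import complex.
Set Implicit Arguments. Unset Strict Implicit. Unset Printing Implicit Defensive.
Import Order.TTheory GRing.Theory Num.Theory.
Local Open Scope ring_scope.

Section Defs.
Variable R : realType.

(* Physicists' Hermite polynomials via the three-term recurrence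
   H_0 = 1, H_1 = 2X, H_{n+1} = 2X H_n - 2n H_{n-1}.
   hermite_pair n = (H_n, H_{n+1}). *)
Fixpoint hermite_pair (n : nat) : {poly R} * {poly R} :=
  match n with
  | 0 => (1, 2%:R *: 'X)
  | n'.+1 => let: (a, b) := hermite_pair n' in
             (b, 2%:R *: 'X * b - (2 * n'.+1)%:R *: a)
  end.

Definition hermiteH (n : nat) : {poly R} := (hermite_pair n).1.

Definition hatH (n : nat) : {poly R} := ((2 ^ n * n`!)%:R)^-1 *: hermiteH n.

Definition hermite_q (K : nat) (gamma : nat -> R) (n : nat) : {poly R} :=
  \sum_(j < K.+1) gamma j *: (if (j <= n)%N then hatH (n - j) else 0).

Definition gamma_P (K : nat) (gamma : nat -> R) : {poly R} :=
  \sum_(j < K.+1) gamma j *: 'X^(K - j).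

Definition croots (p : {poly R}) : seq R[i] :=
  sval (closed_field_poly_normal (map_poly (real_complex R) p)).

Definition n_nonreal (p : {poly R}) : nat :=
  count (fun z : R[i] => complex.Im z != 0) (croots p).
Definition n_real (p : {poly R}) : nat :=
  count (fun z : R[i] => complex.Im z == 0) (croots p).

Definition simple_real_zeros (p : {poly R}) : Prop :=
  forall x : R, root p x -> ~~ root p^`() x.

Definition consecutive (S : pred R) (a b : R) : Prop :=
  [/\ S a, S b, a < b & forall c, S c -> ~ (a < c < b)].

Definition interlace (U V : pred R) : Prop :=
  [/\ (forall v, V v -> exists2 u, U u & forall w, V w -> u < w),
      (forall a b, consecutive U a b -> exists2 v, V v & a < v < b) &
      (forall a b, consecutive V a b -> exists2 u, U u & a < u < b)].

End Defs.

(* Main.v *)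
Require Import Defs.
From HB Require Import structures.
From mathcomp Require Import all_boot all_order all_algebra.
From mathcomp Require boolp.
From mathcomp Require Import reals.
From mathcomp Require Import complex.
From mathcomp Require Import polyorder polyrcf ring lra zify.
Set Implicit Arguments. Unset Strict Implicit. Unset Printing Implicit Defensive.
Import Order.TTheory GRing.Theory Num.Theory.
Local Open Scope ring_scope.

(** Write h_n for the normalized Hermite polynomials, so that h_n' = h_(n-1), and let N be the
    number of non-real zeros of P.

    Upper bound.  Splitting off the real zeros a of P, q_n arises by applying operators 1 - a D
    to the combination of h_n, ..., h_(n-N) attached to the non-real part of P, and this
    combination is the image of a polynomial of degree at most N under a power of 2x - D.  By
    Rolle's theorem (and parity), neither 1 - a D nor 2x - D creates non-real zeros, so q_n has
    at most N of them.  As q_(n+1)' = q_n, the number of non-real zeros is nondecreasing in n.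

    Lower bound.  Off the real axis h_(n-1)(n w) / h_n(n w) tends to 1 / w, hence w^K q_n(n w)
    is asymptotic to h_n(n w) P(w).  Near a non-real zero of P of multiplicity m this forces m
    zeros of q_n(n w): the products of |q_n| over the vertices of two concentric regular polygons
    are compared (a discrete Jensen formula).  So the bound N is attained from some n_0 on.

    Simplicity and interlacing.  For n >= n_0 the zeros of q_n = q_(n+1)' are exactly those given
    by Rolle's theorem, so a double zero x of q_n is a zero of q_(n+1), and then of all later q_m.
    Then sum_m q_m(x) s^m = P*(s) exp(x s - s^2 / 4) would be a polynomial in s, where P* is P
    with reversed coefficients; its differential equation excludes this by comparing degrees. *)

(** * Zeros with multiplicity: the complex list and the sorted real list *)

Section RealZeros.
Variable R : realType.
Implicit Types (p f : {poly R}) (x y : R) (z : R[i]).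
Local Notation toC := (real_complex R).
Local Notation pC p := (map_poly toC p).

Lemma crootsE p :
  pC p = toC (lead_coef p) *: \prod_(z <- croots p) ('X - z%:P).
Proof.
rewrite /croots; case: closed_field_poly_normal => r /= ->.
by rewrite lead_coef_map.
Qed.

Lemma count_croots p z : p != 0 -> count_mem z (croots p) = mup z (pC p).
Proof.
move=> p0; rewrite crootsE -mul_polyC mupMr ?mu_prod_XsubC //.
by rewrite rootC fmorph_eq0 lead_coef_eq0.
Qed.

Lemma mup_map p x : p != 0 -> mup (toC x) (pC p) = mup x p.
Proof.
move=> p0.
have H n : (n <= mup (toC x) (pC p))%N = (n <= mup x p)%N.
  rewrite !mup_geq ?map_poly_eq0 //.
  by rewrite -(dvdp_map toC) rmorphXn /= rmorphB /= map_polyX map_polyC.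
by apply/eqP; rewrite eqn_leq -H leqnn H leqnn.
Qed.

Lemma size_croots p : p != 0 -> size (croots p) = (size p).-1.
Proof.
move=> p0; rewrite -(size_map_poly toC p) crootsE size_scale ?size_prod_XsubC //.
by rewrite fmorph_eq0 lead_coef_eq0.
Qed.

Lemma n_realD p : p != 0 -> (n_real p + n_nonreal p = (size p).-1)%N.
Proof. by move=> p0; rewrite -size_croots // /n_real /n_nonreal count_predC. Qed.

(** Sorting makes neighbouring entries adjacent zeros, so that Rolle's theorem can be applied along
    the list. *)
Definition real_zeros p : seq R :=
  sort <=%O [seq complex.Re z | z <- croots p & complex.Im z == 0].

Lemma real_zeros_sorted p : sorted <=%O (real_zeros p).
Proof. exact: sort_le_sorted. Qed.

Lemma size_real_zeros p : size (real_zeros p) = n_real p.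
Proof. by rewrite size_sort size_map size_filter. Qed.

Lemma count_real_zeros p x : p != 0 -> count_mem x (real_zeros p) = mup x p.
Proof.
move=> p0; rewrite -mup_map // -count_croots // /real_zeros count_sort count_map.
rewrite count_filter; apply: eq_count => -[a b] /=.
by rewrite eq_complex /= andbC.
Qed.

Lemma mem_real_zeros p x : p != 0 -> (x \in real_zeros p) = root p x.
Proof.
move=> p0; rewrite -has_pred1 has_count count_real_zeros //.
by rewrite -XsubC_dvd // dvdp_XsubCl.
Qed.

(** Conjugation permutes [croots p] and exchanges the two open half-planes. This parity later rules
    out a single additional non-real zero. *)
Lemma n_nonreal_even p : p != 0 -> ~~ odd (n_nonreal p).
Proof.
move=> p0.
have cj : map_poly (@conjc R) (pC p) = pC p.
  rewrite -map_poly_comp /=; apply: eq_map_poly => x /=.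
  by rewrite oppr0.
have pe : perm_eq (map (@conjc R) (croots p)) (croots p).
  apply/allP => z _ /=; rewrite count_map.
  apply/eqP; rewrite [RHS]count_croots // -cj.
  rewrite (eq_count (a2 := pred1 (conjc z))); last first.
    by move=> w /=; rewrite (can2_eq (@conjcK R) (@conjcK R)).
  rewrite count_croots //.
  have H n : (n <= mup (conjc z) (pC p))%N = (n <= mup z (map_poly (@conjc R) (pC p)))%N.
    rewrite !mup_geq ?map_poly_eq0 // -(dvdp_map (@conjc R)).
    by rewrite rmorphXn /= rmorphB /= map_polyX map_polyC /= conjcK.
  by apply/eqP; rewrite eqn_leq -H leqnn H leqnn.
rewrite /n_nonreal.
have -> : count (fun z : R[i] => complex.Im z != 0) (croots p) =
  (count (fun z : R[i] => (0 < complex.Im z)%R) (croots p) +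
   count (fun z : R[i] => (complex.Im z < 0)%R) (croots p))%N.
  rewrite -count_predUI [X in (_ + X)%N](eq_count (a2 := pred0)) ?count_pred0 ?addn0.
    by apply: eq_count => z /=; rewrite neq_lt orbC.
  by move=> z /=; case: ltgtP.
rewrite -[X in (X + _)%N](permP pe) count_map.
rewrite (eq_count (a2 := fun z : R[i] => (complex.Im z < 0)%R)).
  by rewrite addnn odd_double.
by move=> [a b] /=; rewrite oppr_gt0.
Qed.

End RealZeros.

(** * Rolle's theorem for $uf - f'$ *)

Section Rolle.
Variable R : realType.
Implicit Types (p f s u : {poly R}) (x y a b : R) (xs ys : seq R).

Lemma mup_factor f x : f != 0 ->
  exists2 s, f = ('X - x%:P) ^+ mup x f * s & ~~ root s x.
Proof.
move=> f0; have := mup_geq x (mup x f) f0; rewrite leqnn => /esym /dvdpP [s fE].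
exists s; first by rewrite mulrC.
apply/negP => /factor_theorem [t sE].
have := mup_geq x (mup x f).+1 f0; rewrite ltnn => /esym /negbT /negP; apply.
by rewrite [X in _ %| X]fE sE -mulrA -exprS dvdp_mull.
Qed.

Lemma deriv_XsubCXM x m s :
  (('X - x%:P) ^+ m.+1 * s)^`() =
  ('X - x%:P) ^+ m * (m.+1%:R *: s + ('X - x%:P) * s^`()).
Proof.
rewrite derivM deriv_exp derivXsubC mul1r /= scaler_nat exprS -mulr_natr -[s *+ _]mulr_natr.
ring.
Qed.

Lemma mup_mulB_deriv f u x : f != 0 -> u * f - f^`() != 0 ->
  ((mup x f).-1 <= mup x (u * f - f^`()))%N.
Proof.
move=> f0 G0; rewrite mup_geq //; case E: (mup x f) => [|m] /=; first by rewrite dvd1p.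
have : (('X - x%:P) ^+ m.+1 %| f) by rewrite -mup_geq // E.
case/dvdpP => s ->; rewrite [s * _]mulrC deriv_XsubCXM exprS.
apply: dvdp_sub; last exact: dvdp_mulr.
by rewrite dvdp_mull // -mulrA dvdp_mull // dvdp_mulr.
Qed.

Lemma no_root_same_sign p a b : a <= b -> {in `[a, b], forall x, ~~ root p x} ->
  0 < p.[a] * p.[b].
Proof.
move=> ab nr; rewrite ltNge; apply/negP => /(polyrcf.poly_ivt ab) [x xab rx].
by move: (nr x xab); rewrite rx.
Qed.

(** For zeros a, b of multiplicity i+1, j+1 and cofactor [s], removing $(X-a)^i (X-b)^j$ from $uf -
    f'$ leaves [B] with values $(i+1)(b-a)s(a)$ at a and $-(j+1)(b-a)s(b)$ at b. These have opposite
    signs because [s] keeps its sign on $[a,b]$. *)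
Lemma root_mulB_deriv_between f u a b : f != 0 -> a < b ->
  root f a -> root f b -> (forall x, a < x < b -> ~~ root f x) ->
  exists2 c, a < c < b & root (u * f - f^`()) c.
Proof.
move=> f0 ab ra rb nr.
have [s1 fE s1a] := mup_factor a f0.
have s10 : s1 != 0 by apply: contraNneq s1a => ->; rewrite root0.
have ma : (0 < mup a f)%N by rewrite -XsubC_dvd // dvdp_XsubCl.
case: (mup a f) ma fE => // i _ fE {ra}.
have s1b : root s1 b.
  by move: rb; rewrite fE rootM rootE !hornerE expf_eq0 subr_eq0 gt_eqF.
have [s s1E sb] := mup_factor b s10.
have mb : (0 < mup b s1)%N by rewrite -XsubC_dvd // dvdp_XsubCl.
case: (mup b s1) mb s1E => // j _ s1E {rb s1b}.
have sa : ~~ root s a by move: s1a; rewrite s1E rootM negb_or => /andP[].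
have ss : 0 < s.[a] * s.[b].
  apply: no_root_same_sign; first exact: ltW.
  move=> x; rewrite in_itv /= => /andP[ax xb].
  have [-> //|xa] := eqVneq x a; have [-> //|xb'] := eqVneq x b.
  have := nr x; rewrite !lt_neqAle eq_sym xa ax xb' xb => /(_ isT).
  by rewrite fE s1E !rootM !negb_or => /and3P[].
pose B := u * ('X - a%:P) * ('X - b%:P) * s -
   (i.+1%:R *: (('X - b%:P) * s) +
     ('X - a%:P) * (j.+1%:R *: s + ('X - b%:P) * s^`())).
have GE : u * f - f^`() = ('X - a%:P) ^+ i * ('X - b%:P) ^+ j * B.
  rewrite fE deriv_XsubCXM s1E deriv_XsubCXM /B -!mul_polyC !exprS; ring.
have : B.[a] * B.[b] < 0.
  rewrite /B !hornerE /=.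
  have ba : 0 < b - a by rewrite subr_gt0.
  set p1 := (i.+1)%:R; set p2 := (j.+1)%:R.
  have p10 : 0 < p1 :> R by rewrite ltr0n.
  have p20 : 0 < p2 :> R by rewrite ltr0n.
  rewrite !subrr.
  have : 0 < (b - a) ^+ 2 * (p1 * p2) * (s.[a] * s.[b]).
    by apply: mulr_gt0 => //; rewrite mulr_gt0 ?exprn_gt0 // mulr_gt0.
  lra.
case/(poly_ivtoo (ltW ab)) => c; rewrite in_itv /= => cab rc.
by exists c => //; rewrite GE rootM rc orbT.
Qed.

(** At the largest zero a, the factor [B] left after removing $(X-a)^i$ has the sign opposite to
    $s(a)$, while the term $2X(X-a)s$ gives it the sign of [s] at infinity. As [s] has no zero from
    a on, [B] changes sign beyond a. *)
Lemma root_raising_above f a : f != 0 -> root f a -> (forall x, a < x -> ~~ root f x) ->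
  exists2 c, a < c & root (2%:R *: 'X * f - f^`()) c.
Proof.
move=> f0 ra nr.
have [s fE sa] := mup_factor a f0.
have s0 : s != 0 by apply: contraNneq sa => ->; rewrite root0.
have ma : (0 < mup a f)%N by rewrite -XsubC_dvd // dvdp_XsubCl.
case: (mup a f) ma fE => // i _ fE.
pose B := 2%:R *: 'X * ('X - a%:P) * s - (i.+1%:R *: s + ('X - a%:P) * s^`()).
have GE : 2%:R *: 'X * f - f^`() = ('X - a%:P) ^+ i * B.
  by rewrite fE deriv_XsubCXM /B -!mul_polyC !exprS; ring.
have nrs : {in `[a, +oo[, forall x, ~~ root s x}.
  move=> x; rewrite in_itv /= andbT le_eqVlt => /orP[/eqP <- //|/nr].
  by rewrite fE rootM negb_or => /andP[].
have [/hasP [c cr ac]|nB] := boolP (has (fun x => a < x) (real_zeros B)).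
  exists c => //; rewrite GE rootM; apply/orP; right.
  have [-> |B0] := eqVneq B 0; first by rewrite root0.
  by rewrite -mem_real_zeros.
have Ba : B.[a] = - (i.+1%:R * s.[a]).
  by rewrite /B !hornerE subrr /=; ring.
have B0 : B != 0.
  apply: contraNneq sa => B0; move: Ba; rewrite B0 horner0 => /esym/eqP.
  by rewrite oppr_eq0 mulf_eq0 pnatr_eq0 /=.
have nrB : {in `[a, +oo[, forall x, ~~ root B x}.
  move=> x; rewrite in_itv /= andbT le_eqVlt => /orP[/eqP <-|ax].
    by rewrite rootE Ba oppr_eq0 mulf_eq0 pnatr_eq0.
  by apply: contra nB => rx; apply/hasP; exists x => //; rewrite mem_real_zeros.
have ai : a \in `[a, +oo[ by rewrite in_itv /= lexx.
have := sgp_pinftyP nrB ai; have := sgp_pinftyP nrs ai.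
have -> : sgp_pinfty B = sgp_pinfty s.
  rewrite /sgp_pinfty /B.
  have s1 : (0 < size s)%N by rewrite size_poly_gt0.
  rewrite lead_coefDl ?lead_coefM ?lead_coefXsubC ?mulr1.
    by rewrite lead_coefZ lead_coefX mulr1 sgrM gtr0_sg ?ltr0n ?mul1r.
  have XB0 : ('X - a%:P) * s != 0 by rewrite mulf_neq0 // polyXsubC_eq0.
  rewrite size_polyN -!mulrA -scalerAl size_scale ?pnatr_eq0 // ['X * _]mulrC size_mulX //.
  rewrite [_ * s]mulrC size_Mmonic ?monicXsubC // size_XsubC addn2 /=.
  rewrite ltnS (leq_trans (size_polyD _ _)) // geq_max.
  rewrite (leq_trans (size_scale_leq _ _)) ?leqnSn //=.
  rewrite (leq_trans (size_polyMleq _ _)) // size_XsubC /=.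
  by rewrite ltnS ltnW // lt_size_deriv.
move=> <-; rewrite Ba sgrN sgrM gtr0_sg ?ltr0n // mul1r => /eqP.
by rewrite eq_sym -addr_eq0 -mulr2n mulrn_eq0 /= sgr_eq0 -rootE (negbTE sa).
Qed.
End Rolle.

(** * Counting real zeros with multiplicity through Rolle's theorem *)

Section Weave.
Variable R : realType.
Implicit Types (p f s u : {poly R}) (x y a b : R) (xs ys : seq R).

(* [ys] lists the zeros that Rolle's theorem provides for the sorted zeros [x :: xs]: a repeated
   zero contributes itself, so that multiplicities are accounted for. *)
Fixpoint weave x xs ys : bool :=
  match xs, ys with
  | [::], [::] => true
  | x' :: xs', y :: ys' =>
      (if x == x' then y == x else x < y < x') && weave x' xs' ys'
  | _, _ => false
  end.

Lemma size_weave x xs ys : weave x xs ys -> size ys = size xs.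
Proof.
elim: xs x ys => [|x' xs IH] x [|y ys] //= /andP[_ /IH ->].
by [].
Qed.

Lemma weave_ge x xs ys y : path <=%O x xs -> weave x xs ys -> y \in ys -> x <= y.
Proof.
elim: xs x ys => [|x' xs IH] x [|y' ys] //= /andP[xx' pth] /andP[h w].
rewrite inE => /orP[/eqP ->|/(IH _ _ pth w)]; last exact: le_trans.
by case: ifP h => _ => [/eqP ->|/andP[/ltW]].
Qed.

Lemma weave_le_last x xs ys y : path <=%O x xs -> weave x xs ys -> y \in ys ->
  y <= last x xs.
Proof.
elim: xs x ys => [|x' xs IH] x [|y' ys] //= /andP[xx' pth] /andP[h w].
have lst : x' <= last x' xs.
  have := pth; rewrite le_path_sortedE => /andP[/allP h1 _].
  by have := mem_last x' xs; rewrite inE => /orP[/eqP ->|/h1].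
rewrite inE => /orP[/eqP ->|/(IH _ _ pth w)] //.
by apply: le_trans lst; case: ifP h => _ => [/eqP ->|/andP[_ /ltW]].
Qed.

(** An m-fold entry of the sorted list produces m-1 copies of itself, and any other point of [ys]
    lies strictly inside one gap, which contributes one point only. *)
Lemma count_weave x xs ys y : path <=%O x xs -> weave x xs ys ->
  (count_mem y ys <= if y \in x :: xs then (count_mem y (x :: xs)).-1 else 1)%N.
Proof.
elim: xs x ys => [|x' xs IH] x [|y' ys] //=.
move=> /andP[xx' pth] /andP[h w].
have {IH} := IH x' ys pth w; rewrite /= !inE.
have ge z : z \in ys -> x' <= z by apply: weave_ge pth w.
have gx z : z \in x' :: xs -> x' <= z.
  rewrite inE => /orP[/eqP ->|] //.
  by have := pth; rewrite le_path_sortedE => /andP[/allP h1 _] /h1.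
case: ifP h => [/eqP -> /eqP -> | nx /andP[xy yx]].
  rewrite ![x' == y]eq_sym; case: (eqVneq y x') => [->|_] /=; last by [].
  by rewrite !add0n !add1n ltnS.
have nyy : y' \notin ys by apply/negP => /ge; rewrite leNgt yx.
have nyx : y' \notin x' :: xs by apply/negP => /gx; rewrite leNgt yx.
have nxy : x \notin ys by apply/negP => /ge; rewrite leNgt lt_neqAle nx xx'.
case: (eqVneq y' y) => [<-|ny] /=.
  rewrite (count_memPn nyy) [y' == x]gt_eqF //=; move: nyx; rewrite inE => /negbTE ->.
  by rewrite addn0.
case: (eqVneq x y) => [yE | _] /=; last by rewrite !add0n.
rewrite -yE (count_memPn nxy) => _; exact: leq0n.
Qed.

(** Equal neighbours contribute themselves, distinct ones a zero from [root_mulB_deriv_between];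
    since the list contains every zero of [f] from [x] on, the gaps are free of zeros of [f]. *)
Lemma rolle_weave f u x xs : f != 0 -> path <=%O x xs -> all (root f) (x :: xs) ->
  (forall z, root f z -> x <= z -> z \in x :: xs) ->
  exists2 ys, weave x xs ys &
    all (fun y => (y \in x :: xs) || root (u * f - f^`()) y) ys.
Proof.
move=> f0; elim: xs x => [|x' xs IH] x /=; first by exists [::].
case/andP=> xx' pth /and3P[rx rx' rxs] hz.
have tl z : z \in x' :: xs -> x' <= z.
  rewrite inE => /orP[/eqP ->|] //.
  by have := pth; rewrite le_path_sortedE => /andP[/allP h1 _] /h1.
have [||ys w ay] := IH x' pth; first by rewrite /= rx'.
  move=> z rz x'z; have := hz z rz (le_trans xx' x'z); rewrite inE => /orP[/eqP zx|//].
  by rewrite inE eq_le x'z {1}zx xx'.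
have sub (y : R) : y \in x' :: xs -> y \in [:: x, x' & xs] by move=> h; rewrite inE h orbT.
have ay' : all (fun y => (y \in [:: x, x' & xs]) || root (u * f - f^`()) y) ys.
  by apply: sub_all ay => y /orP[/sub ->|->] //; rewrite orbT.
have [xE|nx] := eqVneq x x'.
  by exists (x :: ys); [rewrite /= xE !eqxx | rewrite /= ay' inE eqxx].
have ltx : x < x' by rewrite lt_neqAle nx.
have [|c cb rc] := @root_mulB_deriv_between _ f u x x' f0 ltx rx rx'.
  move=> z /andP[xz zx']; apply/negP => /hz /(_ (ltW xz)); rewrite inE gt_eqF //=.
  by move/tl; rewrite leNgt zx'.
by exists (c :: ys) => /=; rewrite ?(negbTE nx) ?cb ?w ?rc ?orbT.
Qed.

Lemma path_real_zeros f x xs : real_zeros f = x :: xs -> path <=%O x xs.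
Proof. by move=> E; have := real_zeros_sorted f; rewrite E. Qed.

Lemma rolle_real_zeros f u x xs : f != 0 -> real_zeros f = x :: xs ->
  exists2 ys, weave x xs ys &
    all (fun y => root f y || root (u * f - f^`()) y) ys.
Proof.
move=> f0 E; have mE z : (z \in x :: xs) = root f z by rewrite -E mem_real_zeros.
have [|z rz|ys w a] := @rolle_weave f u x xs f0 (path_real_zeros E).
- by apply/allP => z; rewrite mE.
- by rewrite mE.
by exists ys => //; apply: sub_all a => y; rewrite mE.
Qed.

(** An m-fold zero of [f] remains a zero of multiplicity at least m-1, and every other entry of [ys]
    is a zero listed once; so the Rolle list is dominated count by count. *)
Lemma weave_count f u x xs ys y : f != 0 -> u * f - f^`() != 0 ->
  real_zeros f = x :: xs -> weave x xs ys ->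
  all (fun y => root f y || root (u * f - f^`()) y) ys ->
  (count_mem y ys <= count_mem y (real_zeros (u * f - f^`())))%N.
Proof.
move=> f0 G0 E w /allP a; have := count_weave y (path_real_zeros E) w.
rewrite -E !count_real_zeros // mem_real_zeros //.
have [yin|/count_memPn -> //] := boolP (y \in ys).
case: ifPn => ry /leq_trans; apply; first exact: mup_mulB_deriv.
by have := a y yin; rewrite (negbTE ry) /= -XsubC_dvd // dvdp_XsubCl.
Qed.

Lemma size_count_le (s t : seq R) : (forall y : R, (count_mem y s <= count_mem y t)%N) ->
  (size s <= size t)%N.
Proof.
move=> h; have /count_subseqP [s' ss pe] : forall y, (count_mem y s <= count_mem y t)%N by [].
by rewrite (perm_size pe) size_subseq.
Qed.

Lemma perm_count_le (s t : seq R) : (forall y : R, (count_mem y s <= count_mem y t)%N) ->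
  (size t <= size s)%N -> perm_eq s t.
Proof.
move=> h; have /count_subseqP [s' ss pe] : forall y, (count_mem y s <= count_mem y t)%N by [].
rewrite (perm_size pe) => le; have [le2 /esym] := size_subseq_leqif ss.
by rewrite eqn_leq le le2 => /eqP <-.
Qed.

Lemma n_real_mulB_deriv f u : f != 0 -> u * f - f^`() != 0 ->
  ((n_real f).-1 <= n_real (u * f - f^`()))%N.
Proof.
move=> f0 G0; rewrite -!size_real_zeros.
case E: (real_zeros f) => [|x xs] //=.
have [ys w a] := rolle_real_zeros u f0 E.
rewrite -(size_weave w); apply: size_count_le => y.
exact: weave_count E w a.
Qed.

(** The Rolle list is one entry short; the zero beyond the last one, from [root_raising_above],
    makes up for it. *)
Lemma n_real_raising f : f != 0 -> 2%:R *: 'X * f - f^`() != 0 ->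
  (n_real f <= n_real (2%:R *: 'X * f - f^`()))%N.
Proof.
move=> f0 G0; rewrite -!size_real_zeros.
case E: (real_zeros f) => [|x xs] //=.
have [ys w a] := rolle_real_zeros (2%:R *: 'X) f0 E.
have pth := path_real_zeros E.
have rl : root f (last x xs) by rewrite -mem_real_zeros // E mem_last.
have [|c lc rc] := root_raising_above f0 rl.
  move=> z; rewrite -mem_real_zeros // E ltNge; apply: contra => zin.
  have : sorted <=%O (x :: xs) by [].
  move: zin; rewrite [x :: xs]lastI mem_rcons inE => /orP[/eqP ->|zin] //.
  rewrite -cats1 (sorted_pairwise le_trans) pairwise_cat allrel1r.
  by case/and3P => /allP /(_ z zin).
rewrite -(size_weave w) -[(size ys).+1]/(size (c :: ys)).
apply: size_count_le => y /=.
have [<-|_] := eqVneq c y; last by rewrite add0n; exact: weave_count E w a.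
rewrite (count_memPn _) ?addn0; last first.
  by apply/negP => /(weave_le_last pth w); rewrite leNgt lc.
by rewrite -has_count has_pred1 mem_real_zeros.
Qed.

Lemma n_realZ (c : R) f : c != 0 -> n_real (c *: f) = n_real f.
Proof.
move=> c0; have [->|f0] := eqVneq f 0; first by rewrite scaler0.
have cf0 : c *: f != 0 by rewrite scaler_eq0 negb_or c0.
have H y : count_mem y (real_zeros (c *: f)) = count_mem y (real_zeros f).
  by rewrite !count_real_zeros // -mul_polyC mupMr // rootC.
rewrite -!size_real_zeros; apply/eqP; rewrite eqn_leq.
by rewrite !size_count_le // => y; rewrite H.
Qed.

(* [size_deriv] is stated over a realDomainType, whose [size] is only convertible to this one. *)
Lemma size_derivE f : size f^`() = (size f).-1.
Proof. exact: size_deriv. Qed.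

(** The degree drops by exactly one and the number of real zeros by at most one. *)
Lemma n_nonreal_deriv f : f^`() != 0 -> (n_nonreal f^`() <= n_nonreal f)%N.
Proof.
move=> d0; have f0 : f != 0 by apply: contraNneq d0 => ->; rewrite deriv0.
have E : -1 *: f^`() = 0 * f - f^`() by rewrite mul0r sub0r scaleN1r.
have := @n_real_mulB_deriv f 0 f0; rewrite -E scaler_eq0 (negbTE d0) orbF oppr_eq0 oner_eq0.
move=> /(_ isT); rewrite n_realZ ?oppr_eq0 ?oner_eq0 //.
have := n_realD d0; have := n_realD f0; rewrite size_derivE.
have : (0 < (size f).-1)%N by rewrite -size_derivE size_poly_gt0.
by lia.
Qed.

(** For $a \neq 0$ the operator is $a(a^{-1} - D)$. It keeps the degree and loses at most one real
    zero, so at most one non-real zero could appear, which parity excludes. *)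
Lemma n_nonreal_subZ_deriv (a : R) f : f != 0 ->
  (n_nonreal (f - a *: f^`()) <= n_nonreal f)%N.
Proof.
move=> f0; have [->|a0] := eqVneq a 0; first by rewrite scale0r subr0.
have sz : size (f - a *: f^`()) = size f.
  rewrite size_polyDl // size_polyN (leq_ltn_trans (size_scale_leq _ _)) //.
  exact: lt_size_deriv.
have G0 : f - a *: f^`() != 0 by rewrite -size_poly_eq0 sz size_poly_eq0.
have E : f - a *: f^`() = a *: (a^-1%:P * f - f^`()).
  by rewrite scalerBr -!mul_polyC mulrA -polyCM divff // mul1r.
have G1 : a^-1%:P * f - f^`() != 0.
  by apply: contraNneq G0; rewrite E => ->; rewrite scaler0.
have h1 := n_real_mulB_deriv f0 G1.
have h2 : n_real (f - a *: f^`()) = n_real (a^-1%:P * f - f^`()) by rewrite E n_realZ.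
have := n_realD G0; have := n_realD f0; rewrite sz.
have := n_nonreal_even f0; have := n_nonreal_even G0.
by rewrite -h2 in h1; move=> /even_halfK e1 /even_halfK e2; lia.
Qed.

Lemma size_raising f : f != 0 -> size (2%:R *: 'X * f - f^`()) = (size f).+1.
Proof.
move=> f0; have s2 : size (2%:R *: 'X * f) = (size f).+1.
  by rewrite -scalerAl size_scale ?pnatr_eq0 // mulrC size_mulX.
by rewrite size_polyDl // size_polyN s2 ltnS ltnW // lt_size_deriv.
Qed.

(** The degree grows by one and the number of real zeros does not fall; parity forbids one more
    non-real zero. *)
Lemma n_nonreal_raising f : f != 0 -> (n_nonreal (2%:R *: 'X * f - f^`()) <= n_nonreal f)%N.
Proof.
move=> f0; have sz := size_raising f0.
have G0 : 2%:R *: 'X * f - f^`() != 0 by rewrite -size_poly_eq0 sz.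
have := n_real_raising f0 G0; have := n_realD G0; have := n_realD f0; rewrite sz.
have := n_nonreal_even f0; have := n_nonreal_even G0.
have := size_poly_gt0 f; rewrite f0.
by lia.
Qed.

Lemma weave_gt x xs ys y : path <=%O x xs -> uniq (x :: xs) -> weave x xs ys ->
  y \in ys -> x < y.
Proof.
elim: xs x ys => [|x' xs IH] x [|y' ys] //= /andP[xx' pth].
rewrite inE negb_or => /and3P[/andP[nx _] u1 u2]; rewrite (negbTE nx) => /andP[/andP[h _] w].
rewrite inE => /orP[/eqP -> //|/(IH _ _ pth _ w)] H; apply: le_lt_trans xx' (H _).
by rewrite /= u1.
Qed.

Lemma weave_separated x xs ys a b : path <=%O x xs -> uniq (x :: xs) -> weave x xs ys ->
  a \in ys -> b \in ys -> a < b -> exists2 c, c \in x :: xs & a < c < b.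
Proof.
elim: xs x ys => [|x' xs IH] x [|y' ys] //= /andP[xx' pth].
move=> /andP[]; rewrite inE negb_or => /andP[nx _] u; rewrite (negbTE nx) => /andP[/andP[h1 h2] w].
rewrite !inE => /orP[/eqP -> | ain] /orP[/eqP -> | bin] ab; first by rewrite ltxx in ab.
- exists x'; first by rewrite !inE eqxx orbT.
  by rewrite h2 (weave_gt pth u w bin).
- by have := lt_trans (lt_trans h2 (weave_gt pth u w ain)) ab; rewrite ltxx.
- by have [c cin ?] := IH _ _ pth u w ain bin ab; exists c => //; rewrite inE cin orbT.
Qed.

(** * The equality case of Rolle's theorem *)

Section Tight.
Variable f : {poly R}.
Hypothesis d0 : f^`() != 0.
Hypothesis tight : n_real f = (n_real f^`()).+1.

Let f0 : f != 0. Proof. by apply: contraNneq d0 => ->; rewrite deriv0. Qed.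

(** The Rolle list has as many entries as $f'$ has real zeros, so domination of counts becomes
    equality of multisets. *)
Lemma tight_weave : exists x xs ys, [/\ real_zeros f = x :: xs, weave x xs ys &
  perm_eq ys (real_zeros f^`())].
Proof.
have E1 : 0 * f - f^`() = -1 *: f^`() by rewrite mul0r sub0r scaleN1r.
have N1 : -1 != 0 :> R by rewrite oppr_eq0 oner_eq0.
have G0 : 0 * f - f^`() != 0 by rewrite E1 scaler_eq0 negb_or N1.
have := size_real_zeros f; rewrite tight; case E: (real_zeros f) => [|x xs] //= [szx].
have [ys w a] := rolle_real_zeros 0 f0 E.
exists x, xs, ys; split=> //; apply: perm_count_le.
  move=> y; apply: leq_trans (weave_count y f0 G0 E w a) _.
  by rewrite !count_real_zeros // E1 -mul_polyC mupMr // rootC.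
by rewrite (size_weave w) szx size_real_zeros.
Qed.

(** Away from the zeros of [f] an entry of the Rolle list occurs once, and here this list exhausts
    the real zeros of $f'$. *)
Lemma tight_double_root y : root f^`() y -> root (f^`()^`()) y -> root f y.
Proof.
move=> r1 r2; have [x [xs [ys [E w pe]]]] := tight_weave.
have m2 : (1 < mup y f^`())%N.
  rewrite mup_geq //; case/factor_theorem: r1 => g gE.
  move: r2; rewrite gE derivM derivXsubC mulr1 rootE !hornerE subrr mulr0 add0r.
  by case/factor_theorem => h ->; rewrite -mulrA -expr2 dvdp_mull.
rewrite -mem_real_zeros // E; apply/negPn/negP => ny.
have := count_weave y (path_real_zeros E) w.
by rewrite (permP pe) count_real_zeros // (negbTE ny) leqNgt m2.
Qed.

(** Simplicity makes the list of zeros of [f] duplicate-free, so each Rolle point lies strictly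
    inside its own gap and two of them are separated by a zero of [f]. *)
Lemma tight_interlace : simple_real_zeros f -> interlace (root f) (root f^`()).
Proof.
move=> sf; have [x [xs [ys [E w pe]]]] := tight_weave.
have mE z : root f z = (z \in x :: xs) by rewrite -mem_real_zeros // E.
have mE' z : root f^`() z = (z \in ys) by rewrite -mem_real_zeros // (perm_mem pe).
have pth := path_real_zeros E.
have u : uniq (x :: xs).
  rewrite -E; apply/count_mem_uniq => z; rewrite count_real_zeros // mem_real_zeros //.
  have [rz|rz] := boolP (root f z); last by rewrite mupNroot.
  apply/eqP; rewrite eqn_leq -XsubC_dvd // dvdp_XsubCl rz andbT leqNgt mup_geq //.
  apply: contra (sf z rz) => /dvdpP [g ->].
  rewrite expr2 mulrA derivM derivXsubC mulr1 rootE !hornerE subrr !mulr0 addr0.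
  by [].
split.
- move=> v _; exists x; first by rewrite mE mem_head.
  by move=> z; rewrite mE' => /(weave_gt pth u w).
- move=> a b [ra rb ab nc].
  have [|c cab rc] := @root_mulB_deriv_between _ f 0 a b f0 ab ra rb.
    by move=> z zab; apply/negP => /nc; apply.
  by exists c => //; move: rc; rewrite mul0r sub0r rootN.
- move=> a b [ra rb ab _]; rewrite mE' in ra; rewrite mE' in rb.
  by have [c cin cab] := weave_separated pth u w ra rb ab; exists c => //; rewrite mE.
Qed.

End Tight.
End Weave.

(** * Hermite polynomials and the upper bound on non-real zeros *)

Section Hermite.
Variable R : realType.
Implicit Types (p f s S P : {poly R}) (x y a b : R) (n j k K N : nat).
Local Notation H := (hermiteH R).
Local Notation h := (hatH R).

Lemma hermiteHSS n : H n.+2 = 2%:R *: 'X * H n.+1 - (2 * n.+1)%:R *: H n.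
Proof. by rewrite /hermiteH /=; case: (hermite_pair R n). Qed.

Lemma deriv_hermiteH n : (H n.+1)^`() = (2 * n.+1)%:R *: H n.
Proof.
have [//] : (H n.+1)^`() = (2 * n.+1)%:R *: H n /\ (H n.+2)^`() = (2 * n.+2)%:R *: H n.+1.
elim: n => [|n [IH1 IH2]].
  have H1 : (H 1)^`() = (2 * 1)%:R *: H 0 by rewrite /hermiteH /= derivZ derivX muln1.
  split=> //; rewrite /hermiteH /= derivB derivM !derivZ derivX derivC -!mul_polyC !natrM.
  ring.
split=> //; rewrite hermiteHSS derivB derivM !derivZ derivX IH2 IH1 [H n.+2]hermiteHSS.
rewrite -!mul_polyC !natrM -(addn1 n.+2) -(addn1 n.+1) !natrD !polyCM !polyCD.
ring.
Qed.

Definition raising p := 2%:R *: 'X * p - p^`().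

Lemma hermiteH_raising n : H n.+1 = raising (H n).
Proof.
rewrite /raising; case: n => [|n]; first by rewrite /hermiteH /= derivC mulr1 subr0.
by rewrite deriv_hermiteH -hermiteHSS.
Qed.

Lemma size_hermiteH n : size (H n) = n.+1.
Proof.
elim: n => [|n IH]; first by rewrite /hermiteH /= size_poly1.
by rewrite hermiteH_raising size_raising ?IH // -size_poly_eq0 IH.
Qed.

Lemma hfact_neq0 n : (2 ^ n * n`!)%:R != 0 :> R.
Proof. by rewrite pnatr_eq0 muln_eq0 expn_eq0 /= -lt0n fact_gt0. Qed.

Lemma size_hatH n : size (h n) = n.+1.
Proof. by rewrite size_scale ?size_hermiteH // invr_eq0 hfact_neq0. Qed.

Lemma hatH0 : h 0 = 1.
Proof. by rewrite /hatH /hermiteH /= expn0 fact0 invr1 scale1r. Qed.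

Lemma deriv_hatH n : (h n.+1)^`() = h n.
Proof.
rewrite /hatH derivZ deriv_hermiteH scalerA; congr (_ *: _).
have := hfact_neq0 n; rewrite expnS factS !natrM => nz.
have n1 : n.+1%:R != 0 :> R by rewrite pnatr_eq0.
move: nz; rewrite mulf_eq0 negb_or => /andP[nz1 nz2].
by field; rewrite nz1 nz2 /= addrC -natr1 in n1 *.
Qed.

Lemma hatHSS n : n.+2%:R *: h n.+2 = 'X * h n.+1 - 2%:R^-1 *: h n.
Proof.
have := hfact_neq0 n; rewrite natrM mulf_eq0 negb_or => /andP[nz1 nz2].
have n1 : 1 + n%:R != 0 :> R by rewrite -mulrS pnatr_eq0.
have n2 : 2 + n%:R != 0 :> R by rewrite -natrD pnatr_eq0.
rewrite /hatH hermiteHSS !scalerBr -scalerAr -scalerAl !scalerA.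
congr (_ *: _ - _ *: _); rewrite !expnS !factS !natrM; field; by rewrite nz1 nz2 n1 n2.
Qed.

Lemma hatH1 : h 1 = 'X.
Proof.
by rewrite /hatH /hermiteH /= expn1 muln1 scalerA mulVf ?scale1r // pnatr_eq0.
Qed.

(** This is the j-th derivative of $h_n$. *)
Definition hatHD j n : {poly R} := if (j <= n)%N then h (n - j) else 0.

Lemma deriv_hatHD j n : (hatHD j n)^`() = hatHD j.+1 n.
Proof.
rewrite /hatHD; case: (ltngtP j n) => [jn|_|->]; last first.
- by rewrite subnn hatH0 derivC.
- by rewrite deriv0.
by rewrite -[(n - j)%N]prednK ?subn_gt0 // deriv_hatH subnS.
Qed.

Lemma size_hatHD j n : (size (hatHD j.+1 n) <= n)%N.
Proof.
by rewrite /hatHD; case: leqP => jn; rewrite ?size_poly0 // size_hatH; lia.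
Qed.

(* The operator [sum_j P_(K-j) D^j] applied to [hatH n]; for [P = gamma_P] this is [q_n]. *)
Definition hermite_comb K P n := \sum_(j < K.+1) P`_(K - j) *: hatHD j n.

Lemma size_comb K P n : P`_K != 0 -> size (hermite_comb K P n) = n.+1.
Proof.
move=> PK; rewrite /hermite_comb big_ord_recl subn0 size_polyDl.
  by rewrite size_scale // /hatHD subn0 size_hatH.
rewrite size_scale // /hatHD subn0 size_hatH ltnS.
apply: (leq_trans (size_sum _ _ _)); apply/bigmax_leqP => i _.
by rewrite (leq_trans (size_scale_leq _ _)) // size_hatHD.
Qed.

Lemma deriv_comb K P n : (hermite_comb K P n)^`() = \sum_(j < K.+1) P`_(K - j) *: hatHD j.+1 n.
Proof. by rewrite /hermite_comb raddf_sum /=; apply: eq_bigr => j _; rewrite derivZ deriv_hatHD. Qed.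

Lemma comb_deriv K P n : (hermite_comb K P n.+1)^`() = hermite_comb K P n.
Proof. by rewrite deriv_comb. Qed.

(** Since coefficients of [P] are read from the top, the factor $X - a$ becomes the operator $1 -
    aD$. *)
Lemma comb_XsubCM K a P n : (size P <= K.+1)%N ->
  hermite_comb K.+1 (('X - a%:P) * P) n = hermite_comb K P n - a *: (hermite_comb K P n)^`().
Proof.
move=> sP; rewrite deriv_comb /hermite_comb.
(* At j = K+1 the truncated index [K - j] would pick up the constant coefficient, hence the
   guard. *)
have E j : (j <= K.+1)%N -> (('X - a%:P) * P)`_(K.+1 - j) =
    (if (j <= K)%N then P`_(K - j) else 0) - a * P`_(K.+1 - j).
  move=> jK; rewrite mulrBl coefB coefXM coefCM subn_eq0 ltnNge.
  by case: leqP => // jK'; rewrite subSn.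
rewrite (eq_bigr (fun j : 'I_K.+2 => (if (j <= K)%N then P`_(K - j) else 0) *: hatHD j n
   - (a * P`_(K.+1 - j)) *: hatHD j n)); last first.
  by move=> j _; rewrite E -1?ltnS // scalerBl.
rewrite sumrB; congr (_ - _).
  rewrite big_ord_recr /= ltnn scale0r addr0; apply: eq_bigr => j _ /=.
  by rewrite -ltnS ltn_ord.
rewrite big_ord_recl /= subn0 (nth_default _ sP) mulr0 scale0r add0r scaler_sumr.
by apply: eq_bigr => j _; rewrite scalerA subSS.
Qed.

Lemma raising_sum I (r : seq I) (c : I -> R) (F : I -> {poly R}) :
  raising (\sum_(i <- r) c i *: F i) = \sum_(i <- r) c i *: raising (F i).
Proof.
rewrite /raising mulr_sumr raddf_sum -sumrB; apply: eq_bigr => i _ /=.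
by rewrite derivZ scalerBr scalerAr.
Qed.

Lemma n_nonreal_iter_raising k f : f != 0 ->
  iter k raising f != 0 /\ (n_nonreal (iter k raising f) <= n_nonreal f)%N.
Proof.
move=> f0; elim: k => [|k [nz le]] //=; split.
  by rewrite -size_poly_eq0 size_raising.
exact: leq_trans (n_nonreal_raising nz) le.
Qed.

(** For $j \le N$, $H_{n-j}$ arises from $H_{N-j}$ by n-N raisings; the normalizing factors of
    $h_{n-j}$ stay behind as constants. *)
Lemma comb_iter_raising N S n : (N <= n)%N -> hermite_comb N S n = iter (n - N) raising
  (\sum_(j < N.+1) (S`_(N - j) / (2 ^ (n - j) * (n - j)`!)%:R) *: H (N - j)).
Proof.
move=> Nn; have E k : iter k raising
  (\sum_(j < N.+1) (S`_(N - j) / (2 ^ (n - j) * (n - j)`!)%:R) *: H (N - j)) =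
   \sum_(j < N.+1) (S`_(N - j) / (2 ^ (n - j) * (n - j)`!)%:R) *: H (k + (N - j)).
  elim: k => [|k IH] //=; rewrite IH raising_sum; apply: eq_bigr => j _.
  by rewrite addSn hermiteH_raising.
rewrite E; apply: eq_bigr => j _; have jN : (j <= N)%N by rewrite -ltnS.
rewrite /hatHD (leq_trans jN Nn) /hatH scalerA; congr (_ *: H _); lia.
Qed.

(** The polynomial being raised has degree at most N, and raising adds no non-real zero. For n < N
    the degree n of the combination already suffices. *)
Lemma n_nonreal_comb_le N S n : S`_N != 0 -> (n_nonreal (hermite_comb N S n) <= N)%N.
Proof.
move=> SN; have sz := size_comb n SN.
have nz : hermite_comb N S n != 0 by rewrite -size_poly_eq0 sz.
have [nN|Nn] := ltnP n N.
  have := n_realD nz; rewrite sz /= => E; lia.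
move: nz; rewrite comb_iter_raising //; set g := \sum_(_ < _) _ => nz.
have g0 : g != 0.
  apply: contraNneq nz => ->; have raising0 : raising 0 = 0 by rewrite /raising mulr0 deriv0 subr0.
  by elim: (n - N)%N => [|k /eqP IHk] /=; rewrite ?IHk ?raising0 eqxx.
have [_ le] := n_nonreal_iter_raising (n - N) g0; apply: leq_trans le _.
have := n_realD g0.
have : (size g <= N.+1)%N.
  apply: (leq_trans (size_sum _ _ _)); apply/bigmax_leqP => i _.
  by rewrite (leq_trans (size_scale_leq _ _)) // size_hermiteH; lia.
lia.
Qed.

Lemma prod_XsubC_factor (s : seq R) p : p != 0 ->
  (forall y, (count_mem y s <= mup y p)%N) ->
  exists S, p = \prod_(x <- s) ('X - x%:P) * S.
Proof.
elim: s p => [|x s IH] p p0 c; first by exists p; rewrite big_nil mul1r.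
have /dvdpP [g gE] : 'X - x%:P %| p.
  by rewrite XsubC_dvd //; apply: leq_trans (c x); rewrite /= eqxx.
have g0 : g != 0 by apply: contraNneq p0 => g0; rewrite gE g0 mul0r.
have [|S SE] := IH g g0.
  move=> y; have := c y; rewrite gE mupM ?polyXsubC_eq0 // -['X - _]expr1 mup_XsubCX /=.
  by rewrite addnC; case: (x == y); rewrite ?leq_add2r ?addn0.
by exists S; rewrite big_cons -mulrA -SE mulrC.
Qed.

Lemma real_zeros_factor p : p != 0 ->
  exists2 S, p = \prod_(x <- real_zeros p) ('X - x%:P) * S & size S = (n_nonreal p).+1.
Proof.
move=> p0; have [|S SE] := @prod_XsubC_factor (real_zeros p) p p0.
  by move=> y; rewrite count_real_zeros.
exists S => //; have S0 : S != 0 by apply: contraNneq p0 => S0; rewrite SE S0 mulr0.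
have := n_realD p0; rewrite {3}SE size_monicM ?monic_prod_XsubC // size_prod_XsubC.
rewrite size_real_zeros; have := size_poly_gt0 S; rewrite S0; case: (size S) => // m _.
by rewrite addnS addSn /= => /addnI ->.
Qed.

(** Each factor $X - x$ is peeled off as an operator $1 - xD$, until only [S] remains. *)
Lemma n_nonreal_comb_prod N S n (s : seq R) : size S = N.+1 ->
  (n_nonreal (hermite_comb (size s + N) (\prod_(x <- s) ('X - x%:P) * S) n) <= N)%N.
Proof.
move=> sS; have S0 : S != 0 by rewrite -size_poly_eq0 sS.
elim: s => [|x s IH] /=.
  by rewrite big_nil mul1r n_nonreal_comb_le // -[N]/(N.+1.-1) -sS lead_coef_eq0.
have sz : size (\prod_(x <- s) ('X - x%:P) * S) = (size s + N).+1.
  by rewrite size_monicM ?monic_prod_XsubC // size_prod_XsubC sS addSn addnS.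
rewrite big_cons -mulrA addSn comb_XsubCM ?sz //.
apply: leq_trans IH; apply: n_nonreal_subZ_deriv.
rewrite -size_poly_eq0 size_comb //.
rewrite -[(size s + N)%N]/((size s + N).+1.-1) -sz lead_coef_eq0 -size_poly_eq0 sz //.
Qed.

Lemma n_nonreal_comb K P n : size P = K.+1 ->
  (n_nonreal (hermite_comb K P n) <= n_nonreal P)%N.
Proof.
move=> sP; have P0 : P != 0 by rewrite -size_poly_eq0 sP.
have [S SE sS] := real_zeros_factor P0.
have -> : K = (size (real_zeros P) + n_nonreal P)%N.
  by rewrite size_real_zeros n_realD // sP.
rewrite {3}SE; exact: n_nonreal_comb_prod.
Qed.

Lemma coef_gamma_P K (gamma : nat -> R) j : (j <= K)%N -> (gamma_P K gamma)`_(K - j) = gamma j.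
Proof.
move=> jK; rewrite /gamma_P coef_sum (bigD1 (Ordinal (jK : j < K.+1)%N)) //=.
rewrite coefZ coefXn eqxx mulr1 big1 ?addr0 // => i ne.
rewrite coefZ coefXn; case: eqP => [E|_]; last by rewrite mulr0.
case/eqP: ne; apply: val_inj => /=; have := ltn_ord i; lia.
Qed.

Lemma hermite_q_comb K gamma n : hermite_q K gamma n = hermite_comb K (gamma_P K gamma) n.
Proof. by apply: eq_bigr => j _; rewrite coef_gamma_P // -ltnS. Qed.

Lemma size_gamma_P K (gamma : nat -> R) : gamma 0%N = 1 -> size (gamma_P K gamma) = K.+1.
Proof.
move=> g0; rewrite /gamma_P big_ord_recl g0 scale1r subn0 size_polyDl size_polyXn // ltnS.
apply: (leq_trans (size_sum _ _ _)); apply/bigmax_leqP => i _.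
by rewrite (leq_trans (size_scale_leq _ _)) // size_polyXn /=; have := ltn_ord i; rewrite /bump /=; lia.
Qed.

End Hermite.

(** * A polynomial times $\exp(xs - s^2/4)$ is not a polynomial in s *)

Section NoCommonZero.
Variable R : realType.
Implicit Types (A G : {poly R}) (x : R).

Lemma dvdp_XnP (p : {poly R}) L : (forall m, (m < L)%N -> p`_m = 0) -> 'X^L %| p.
Proof.
move=> h; apply/dvdpP; exists (drop_poly L p).
rewrite -[LHS](poly_take_drop L) -[RHS]add0r; congr (_ + _).
by apply/polyP => m; rewrite coef_take_poly coef0; case: ifP => // /h.
Qed.

(** The recurrence says that $E = \sum_m e_m s^m$ satisfies $E' = QE$ with $Q = x - s/2$. From $A =
    GE$ follows $A'G = (G' + QG)A$, where the right side has the larger degree because Q has degree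
    one. *)
Lemma gauss_series_not_poly (e : nat -> R) x A G :
  e 1%N = x * e 0%N -> (forall m, m.+2%:R * e m.+2 = x * e m.+1 - 2^-1 * e m) ->
  (forall m, A`_m = \sum_(j < m.+1) G`_j * e (m - j)%N) ->
  A != 0 -> G != 0 -> False.
Proof.
move=> e1 erec AE A0 G0.
(* [L] bounds the size of [D] below, so divisibility of [D] by $X^L$, of size L+1, forces D = 0. *)
pose L := (size A + size G).+1.
pose E := \poly_(m < L.+1) e m.
pose Q := x%:P - 2^-1 *: 'X.
have [U UE] : exists U : {poly R}, A = G * E + U * 'X^(L.+1).
  have /dvdpP [U UE] : 'X^(L.+1) %| A - G * E.
    apply: dvdp_XnP => m mL; rewrite coefB coefM AE.
    apply/eqP; rewrite subr_eq0; apply/eqP; apply: eq_bigr => j _.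
    by rewrite coef_poly (leq_ltn_trans (leq_subr _ _) mL).
  by exists U; rewrite -UE addrC subrK.
have [W WE] : exists W : {poly R}, E^`() = Q * E + W * 'X^L.
  have /dvdpP [W WE] : 'X^L %| E^`() - Q * E.
    apply: dvdp_XnP => m mL; rewrite coefB coef_deriv mulrBl coefB coefCM -scalerAl coefZ coefXM.
    rewrite !coef_poly ltnS mL (ltn_trans mL) //.
    case: m mL => [|m] mL /=; first by rewrite e1 mulr1n mulr0 subr0 subrr.
    rewrite (ltn_trans (ltnSn m)) ?(ltn_trans mL) //.
    by rewrite -[X in X - _]mulr_natl erec subrr.
  by exists W; rewrite -WE addrC subrK.
have sQ : size Q = 2%N.
  rewrite /Q addrC size_polyDl ?size_polyN size_scale ?invr_eq0 ?pnatr_eq0 // size_polyX //.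
  by rewrite ltnS size_polyC_leq1.
have sQG' : size (G^`() + Q * G) = (size G).+1.
  have Q0 : Q != 0 by rewrite -size_poly_eq0 sQ.
  have sQG : size (Q * G) = (size G).+1 by rewrite size_mul // sQ.
  by rewrite addrC size_polyDl sQG // ltnS ltnW // lt_size_deriv.
have sQG : (size (G^`() + Q * G)%R <= (size G).+1)%N by rewrite sQG'.
pose D := A^`() * G - (G^`() + Q * G) * A.
have D0 : D = 0.
  have dv : 'X^L %| D.
    (* Inserting $A = GE + UX^{L+1}$ and $E' = QE + WX^L$ cancels all terms without the factor
       $X^L$; the quotient remains. *)
    apply/dvdpP; exists (G * G * W + U^`() * 'X * G + U *+ L.+1 * G - (G^`() + Q * G) * U * 'X).
    rewrite /D UE derivD [(G * E)^`()]derivM [(U * _)^`()]derivM derivXn WE /= exprS.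
    rewrite -[in LHS]mulr_natr -[in RHS]mulr_natr.
    ring.
  apply/eqP/negPn/negP => Dn0; have := dvdp_leq Dn0 dv.
  rewrite size_polyXn leqNgt ltnS; apply/negP; rewrite negbK.
  apply: (leq_trans (size_polyD _ _)); rewrite size_polyN geq_max.
  have sM (p q : {poly R}) a b : (size p <= a)%N -> (size q <= b)%N -> (size (p * q)%R <= a + b)%N.
    move=> pa qb; apply: leq_trans (size_polyMleq _ _) _; apply: leq_trans (leq_pred _) _.
    exact: leq_add.
  rewrite /L leqW ?sM //=; last by rewrite ltnW // lt_size_deriv.
  apply: leq_trans (sM _ _ (size G).+1 _ sQG (leqnn _)) _.
  by rewrite addSn addnC.
move/eqP: D0; rewrite subr_eq0 => /eqP DE.
have sA : (0 < size A)%N by rewrite size_poly_gt0.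
have : (size (A^`() * G)%R < size A + size G)%N.
  apply: leq_ltn_trans (size_polyMleq _ _) _.
  have := lt_size_deriv A0; have := size_poly_gt0 G; rewrite G0.
  by move: (size _) (size _) sA => a b; lia.
have QG0 : G^`() + Q * G != 0 by rewrite -size_poly_eq0 sQG'.
rewrite DE size_mul // sQG' addSn /=.
by rewrite addnC ltnn.
Qed.
End NoCommonZero.

(** * Products over the vertices of regular polygons *)

Section Circles.
Variable R : realType.
Local Notation C := R[i].
Local Notation nm := (@ComplexField.Normc.normc R).
Implicit Types (z w u : C) (ws : seq C).

Lemma nmM z w : nm (z * w) = nm z * nm w. Proof. exact: ComplexField.Normc.normcM. Qed.
Lemma nmD z w : nm (z + w) <= nm z + nm w. Proof. exact: le_normcD. Qed.
Lemma nmN z : nm (- z) = nm z. Proof. exact: normcN. Qed.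
Lemma nm1 : nm 1 = 1. Proof. exact: ComplexField.Normc.normc1. Qed.
Lemma nm0 : nm 0 = 0. Proof. exact: ComplexField.Normc.normc0. Qed.
Lemma nm_ge0 z : 0 <= nm z. Proof. by case: z => a b; exact: sqrtr_ge0. Qed.
Lemma nm_eq0 z : (nm z == 0) = (z == 0).
Proof.
by apply/eqP/eqP => [|->]; [exact: ComplexField.Normc.eq0_normc | exact: nm0].
Qed.
Lemma nm_gt0 z : (0 < nm z) = (z != 0).
Proof. by rewrite lt_neqAle nm_ge0 andbT eq_sym nm_eq0. Qed.
Lemma nmBC z w : nm (z - w) = nm (w - z). Proof. by rewrite -nmN opprB. Qed.
Lemma nmB z w : nm z - nm w <= nm (z - w).
Proof. by rewrite lerBlDr -{1}(subrK w z) nmD. Qed.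
Lemma nm_real (a : R) : nm (a%:C)%C = `|a|.
Proof. by rewrite /= expr0n addr0 sqrtr_sqr. Qed.
Lemma nmX z n : nm (z ^+ n) = nm z ^+ n.
Proof. by elim: n => [|n IH]; rewrite ?expr0 ?nm1 // !exprS nmM IH. Qed.
Lemma nm_prod I (s : seq I) (P : pred I) (F : I -> C) :
  nm (\prod_(i <- s | P i) F i) = \prod_(i <- s | P i) nm (F i).
Proof. exact: (big_morph nm nmM nm1). Qed.
Lemma nm_sum I (s : seq I) (P : pred I) (F : I -> C) :
  nm (\sum_(i <- s | P i) F i) <= \sum_(i <- s | P i) nm (F i).
Proof.
elim/big_rec2: _ => [|i x y _ le]; first by rewrite nm0.
by apply: le_trans (nmD _ _) _; rewrite lerD2l.
Qed.
Lemma nm_Im z : `|complex.Im z| <= nm z.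
Proof.
by case: z => a b /=; rewrite -sqrtr_sqr ler_wsqrtr // lerDr sqr_ge0.
Qed.

(** The points are the zeros of $X^M - r^M$. *)
Lemma circle_points M (r : R) : (0 < M)%N -> 0 <= r -> exists zs : seq C,
  [/\ size zs = M, {in zs, forall z, nm z = r} &
      forall u, \prod_(z <- zs) (u - z) = u ^+ M - (r%:C)%C ^+ M].
Proof.
move=> M0 r0; have [zs] := closed_field_poly_normal ('X^M - ((r%:C)%C ^+ M)%:P).
rewrite lead_coefXnsubC // scale1r => E.
have ev u : \prod_(z <- zs) (u - z) = u ^+ M - (r%:C)%C ^+ M.
  have := congr1 (horner^~ u) E; rewrite !hornerE horner_prod => ->.
  by apply: eq_bigr => z _; rewrite !hornerE.
exists zs; split=> //.
- have := congr1 (fun p : {poly C} => size p) E; rewrite size_XnsubC // size_prod_XsubC.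
  by case.
- move=> z zin; have := ev z; rewrite (big_rem z) //= subrr mul0r => /esym/eqP.
  rewrite subr_eq0 => /eqP /(congr1 nm); rewrite !nmX nm_real ger0_norm // => /eqP.
  by rewrite eqrXn2 ?nm_ge0 // => /eqP.
Qed.

(** The modulus at z of the monic polynomial with zeros [ws]. *)
Definition dist_prod ws z : R := \prod_(w <- ws) nm (z - w).

Lemma dist_prod_ge0 ws z : 0 <= dist_prod ws z.
Proof. by apply: prodr_ge0 => w _; exact: nm_ge0. Qed.

Section OneCircle.
Variables (M : nat) (r : R) (z0 : C) (zs : seq C).
Hypotheses (M0 : (0 < M)%N) (r0 : 0 < r) (szs : size zs = M).
Hypothesis nzs : {in zs, forall z, nm z = r}.
Hypothesis zsE : forall u, \prod_(z <- zs) (u - z) = u ^+ M - (r%:C)%C ^+ M.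

(** Exchanging the two products gives the discrete Jensen formula: each w enters only through
    $|(w-z_0)^M - r^M|$. *)
Lemma circle_dist_prod ws :
  \prod_(z <- zs) dist_prod ws (z0 + z) = \prod_(w <- ws) nm ((w - z0) ^+ M - (r%:C)%C ^+ M).
Proof.
rewrite exchange_big; apply: eq_bigr => w _; rewrite -zsE nm_prod.
by apply: eq_bigr => z _; rewrite -nmN; congr nm; ring.
Qed.

(** Outside the annulus from r/2 to 2r, one of $|u|^M$ and $r^M$ is at least twice the other. *)
Lemma pow_gap u : nm u <= r / 2 \/ 2 * r <= nm u ->
  r ^+ M / 2 <= nm (u ^+ M - (r%:C)%C ^+ M).
Proof.
case: M M0 => // k _ h; have rk : 0 < r ^+ k.+1 by rewrite exprn_gt0.
have nr : nm ((r%:C)%C ^+ k.+1) = r ^+ k.+1 by rewrite nmX nm_real gtr0_norm.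
have p2 : 2 <= 2 ^+ k.+1 :> R by rewrite exprS ler_peMr // exprn_ege1 // ler1n.
case: h => h.
  have := nmB ((r%:C)%C ^+ k.+1) (u ^+ k.+1); rewrite nmBC nr nmX.
  have : nm u ^+ k.+1 <= r ^+ k.+1 / 2.
    apply: le_trans (_ : (r / 2) ^+ k.+1 <= _).
      by rewrite lerXn2r ?nnegrE ?nm_ge0 // ltW // divr_gt0.
    rewrite expr_div_n ler_pM2l // lef_pV2 ?posrE ?exprn_gt0 //.
  lra.
have := nmB (u ^+ k.+1) ((r%:C)%C ^+ k.+1); rewrite nr nmX.
have : (2 * r) ^+ k.+1 <= nm u ^+ k.+1.
  by rewrite lerXn2r ?nnegrE ?nm_ge0 // mulr_ge0 // ltW.
rewrite exprMn; have : 2 * r ^+ k.+1 <= 2 ^+ k.+1 * r ^+ k.+1 by rewrite ler_pM2r.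
lra.
Qed.

Lemma circle_lower_inner ws :
  (forall w, w \in ws -> nm (w - z0) <= r / 2 \/ 2 * r <= nm (w - z0)) ->
  (r ^+ M / 2) ^+ size ws <= \prod_(z <- zs) dist_prod ws (z0 + z).
Proof.
move=> h; rewrite circle_dist_prod; elim: ws h => [|w ws IH] h; first by rewrite big_nil.
have r2 : 0 <= r ^+ M / 2 by rewrite divr_ge0 // exprn_ge0 // ltW.
rewrite big_cons /= exprS ler_pM ?exprn_ge0 //; first by apply: pow_gap; apply: h; rewrite mem_head.
by apply: IH => v vin; apply: h; rewrite inE vin orbT.
Qed.


Lemma prod_le_exp (F : C -> R) (a : R) (s : seq C) : (forall z, z \in s -> 0 <= F z <= a) ->
  \prod_(z <- s) F z <= a ^+ size s.
Proof.
elim: s => [|z s IH] h; first by rewrite big_nil expr0.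
have /andP[f0 fa] := h z (mem_head _ _).
have h' w : w \in s -> 0 <= F w <= a by move=> ws; apply: h; rewrite inE ws orbT.
rewrite big_cons exprS ler_pM // ?IH // big_seq; apply: prodr_ge0 => w /h' /andP[].
by [].
Qed.

Lemma circle_upper_inner ws : (forall w, w \in ws -> nm (w - z0) <= 2 * r) ->
  \prod_(z <- zs) dist_prod ws (z0 + z) <= ((3 * r) ^+ size ws) ^+ M.
Proof.
move=> h; rewrite -szs; apply: prod_le_exp => z /nzs nz; rewrite dist_prod_ge0 /=.
apply: prod_le_exp => w /h wz; rewrite nm_ge0 /=.
have -> : z0 + z - w = z - (w - z0) by ring.
have := nmD z (- (w - z0)); rewrite nmN nz; lra.
Qed.

Variable e : R.
Hypothesis e_ge0 : 0 <= e.

Lemma pow_far u : r ^+ M <= e * nm u ^+ M ->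
  (1 - e) * nm u ^+ M <= nm (u ^+ M - (r%:C)%C ^+ M) <= (1 + e) * nm u ^+ M.
Proof.
move=> h; have nr : nm ((r%:C)%C ^+ M) = r ^+ M by rewrite nmX nm_real gtr0_norm.
have := nmB (u ^+ M) ((r%:C)%C ^+ M); have := nmD (u ^+ M) (- (r%:C)%C ^+ M).
rewrite nmN nr nmX => h1 h2; apply/andP; split; lra.
Qed.

Lemma bernoulli n : e <= 1 -> 1 - n%:R * e <= (1 - e) ^+ n.
Proof.
move=> e1; elim: n => [|n IH]; first by rewrite mul0r subr0 expr0.
rewrite exprS; apply: le_trans (_ : (1 - e) * (1 - n%:R * e) <= _).
  rewrite -natr1; have : 0 <= n%:R * e * e by rewrite !mulr_ge0.
  lra.
by rewrite ler_wpM2l // subr_ge0.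
Qed.

(** A far point w contributes $|w-z_0|^M$ up to a factor between 1-e and 1+e, and the product of
    these factors over [ws] stays between 1/2 and 2. *)
Lemma circle_far ws : (size ws)%:R * e <= 1 / 2 -> e <= 1 / 2 ->
  (forall w, w \in ws -> r ^+ M <= e * nm (w - z0) ^+ M) ->
  dist_prod ws z0 ^+ M / 2 <= \prod_(z <- zs) dist_prod ws (z0 + z) <= 2 * dist_prod ws z0 ^+ M.
Proof.
move=> ne e2 h; rewrite circle_dist_prod.
have e1 : 0 <= 1 - e by rewrite subr_ge0 (le_trans e2) //; lra.
have e1' : 0 <= 1 + e by rewrite addr_ge0.
have : (1 - e) ^+ size ws * dist_prod ws z0 ^+ M <= \prod_(w <- ws) nm ((w - z0) ^+ M - (r%:C)%C ^+ M)
   <= (1 + e) ^+ size ws * dist_prod ws z0 ^+ M.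
  elim: ws h {ne} => [|w ws IH] h.
    by rewrite /dist_prod !big_nil !expr0 expr1n mulr1 lexx.
  have /andP[l1 l2] : (1 - e) ^+ size ws * dist_prod ws z0 ^+ M <=
     \prod_(w <- ws) nm ((w - z0) ^+ M - (r%:C)%C ^+ M) <= (1 + e) ^+ size ws * dist_prod ws z0 ^+ M.
    by apply: IH => v vin; apply: h; rewrite inE vin orbT.
  have /andP[k1 k2] := pow_far (h w (mem_head _ _)).
  rewrite big_cons /= [dist_prod _ _]big_cons -/(dist_prod ws z0) nmBC exprMn !exprS.
  apply/andP; split; [rewrite [leLHS]mulrACA | rewrite [leRHS]mulrACA]; apply: ler_pM => //.
  - by rewrite mulr_ge0 // exprn_ge0 // nm_ge0.
  - by rewrite mulr_ge0 // exprn_ge0 // dist_prod_ge0.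
  - exact: nm_ge0.
  - by apply: prodr_ge0 => v _; exact: nm_ge0.
case/andP => l1 l2.
have b : 1 / 2 <= (1 - e) ^+ size ws.
  apply: le_trans (bernoulli _ _); lra.
(* The upper bound comes from $(1+e)^n(1-e)^n \le 1$ and the lower bound 1/2. *)
have b2 : (1 + e) ^+ size ws <= 2.
  have : ((1 + e) * (1 - e)) ^+ size ws <= 1.
    apply: exprn_ile1; last by nra.
    by rewrite mulr_ge0 //; lra.
  rewrite exprMn => b3; rewrite -[leRHS]mulr1.
  have p0 : 0 <= (1 + e) ^+ size ws by rewrite exprn_ge0 //; lra.
  have : (1 + e) ^+ size ws * (1 / 2) <= (1 + e) ^+ size ws * (1 - e) ^+ size ws by rewrite ler_wpM2l.
  lra.
have d0 : 0 <= dist_prod ws z0 ^+ M by rewrite exprn_ge0 // dist_prod_ge0.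
apply/andP; split.
  by apply: le_trans l1; rewrite mulrC ler_wpM2r // -[2^-1]mul1r.
by apply: le_trans l2 _; rewrite ler_wpM2r.
Qed.

End OneCircle.

(* Pigeonhole over the radii [r / kappa ^ j]: each point spoils at most one of them. *)
Lemma good_radius (m : nat) (r kappa : R) (ds : seq R) : 0 < r -> 4 <= kappa ->
  (size ds < m)%N -> exists2 j, (0 < j <= m)%N &
    forall d, d \in ds -> d <= r / kappa ^+ j / 2 \/ 2 * (r / kappa ^+ j) <= d.
Proof.
move=> r0 k4 sm; have k0 : 0 < kappa by lra.
pose bad j d := (r / kappa ^+ j / 2 < d) && (d < 2 * (r / kappa ^+ j)).
have [/existsP [j /hasPn nb]|/existsPn ab] :=
    boolP [exists j : 'I_m, ~~ has (bad j.+1) ds].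
  exists j.+1; first exact: ltn_ord.
  by move=> d /nb; rewrite /bad negb_and -!leNgt => /orP[] ?; [left|right].
pose f (j : 'I_m) := find (bad j.+1) ds.
have fl (j : 'I_m) : (f j < size ds)%N by rewrite -has_find; have := ab j; rewrite negbK.
pose g j := Ordinal (fl j).
suff /leq_card : injective g by rewrite !card_ord leqNgt sm.
have bf (j : 'I_m) : bad j.+1 (nth 0 ds (f j)) by apply: nth_find; have := ab j; rewrite negbK.
(* The two radii differ by a factor of at least 4, so the annuli from half to twice each radius are
   disjoint. *)
have lt (i j : 'I_m) : (i < j)%N -> f i <> f j.
  move=> ij E; have := bf i; have := bf j; rewrite E /bad => /andP[_ h1] /andP[h2 _].
  have : r / kappa ^+ j.+1 * 4 <= r / kappa ^+ i.+1.
    have k1 : 4 <= kappa ^+ (j - i).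
      case: (j - i)%N (subn_gt0 i j) => [|k]; first by rewrite ij.
      by move=> _; rewrite exprS (le_trans k4) // ler_peMr ?exprn_ege1 //; lra.
    have -> : kappa ^+ j.+1 = kappa ^+ i.+1 * kappa ^+ (j - i).
      by rewrite -exprD; congr (_ ^+ _); lia.
    have kp n : 0 < kappa ^+ n by rewrite exprn_gt0.
    rewrite invfM mulrA -mulrA ler_piMr //; first by rewrite ltW // divr_gt0.
    by rewrite mulrC ler_pdivrMr // mul1r.
  lra.
move=> i j /(congr1 val) /= E; apply: val_inj => /=.
by case: (ltngtP i j) => // /lt; rewrite E.
Qed.

End Circles.

(** * Counting zeros near a point by comparing two circles *)

Section LocalCount.
Variable R : realType.
Local Notation C := R[i].
Local Notation nm := (@ComplexField.Normc.normc R).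
Implicit Types (z w u : C) (ws : seq C).

(** Distance at least 2r gives $s^M \le 2^{-M}|w-z_0|^M$, so [circle_far] applies with $e = 2^{-M}$;
    fewer than M points keep the total error below 1/2. *)
Lemma circle_far_pow2 M (r s : R) z0 zs ws : (0 < M)%N -> 0 < s <= r ->
  (forall u, \prod_(z <- zs) (u - z) = u ^+ M - (s%:C)%C ^+ M) ->
  (size ws < M)%N -> (forall w, w \in ws -> 2 * r <= nm (w - z0)) ->
  dist_prod ws z0 ^+ M / 2 <= \prod_(z <- zs) dist_prod ws (z0 + z) <= 2 * dist_prod ws z0 ^+ M.
Proof.
move=> M0 /andP[s0 sr] zsE sM h.
have p2 : 0 < 2 ^+ M :> R by rewrite exprn_gt0.
apply: (circle_far s0 zsE (e := 2 ^- M)).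
- by rewrite invr_ge0 ltW.
- rewrite ler_pdivrMr // mul1r; case: M sM {zsE M0 p2} => // k; rewrite ltnS => sk.
  rewrite exprS mulKf ?pnatr_eq0 // -natrX ler_nat (leq_trans sk) // ltnW // ltn_expl //.
- case: M M0 {zsE sM p2} => // k _; rewrite exprS invfM mul1r ler_piMr ?invr_ge0 //.
  by rewrite invf_le1 ?exprn_gt0 // exprn_ege1 // ler1n.
- move=> w /h hw; rewrite mulrC ler_pdivlMr // -exprMn lerXn2r ?nnegrE ?nm_ge0 //.
    by rewrite mulr_ge0 // ltW.
  by apply: le_trans hw; rewrite mulrC ler_pM2l.
Qed.

Lemma prod_scale (t : R) (F : C -> R) (zs : seq C) :
  \prod_(z <- zs) (t * F z) = t ^+ size zs * \prod_(z <- zs) F z.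
Proof.
elim: zs => [|z zs IH]; first by rewrite !big_nil mulr1.
by rewrite !big_cons IH /= exprS mulrACA.
Qed.

(** Here [inner] and [outer] are the zeros of the function under study and [hs] those of the
    comparison function. With only l < m inner zeros, the polygons of radius r and of a good smaller
    radius s yield $c r^m s^l \le 16 \cdot 2^l (3r)^l D s^m$, that is $c(r/s)^{m-l} \le 16 \cdot 6^l
    D$. Since r/s is at least [kappa], this contradicts the choice of [kappa]. *)
Lemma local_roots (m : nat) (r c D kappa a b : R) z0 (inner outer hs : seq C) :
  0 < r -> 0 < c -> 0 < D -> 4 <= kappa -> 16 * 6 ^+ m * D < c * kappa ->
  0 < a -> 0 < b ->
  (forall w, w \in inner -> nm (w - z0) <= 2 * r) ->
  (forall w, w \in outer -> 2 * r <= nm (w - z0)) ->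
  (forall w, w \in hs -> 2 * r <= nm (w - z0)) ->
  (forall z, nm (z - z0) = r ->
     c * r ^+ m * (b * dist_prod hs z) <= a * (dist_prod inner z * dist_prod outer z)) ->
  (forall z j, (0 < j <= m)%N -> nm (z - z0) = r / kappa ^+ j ->
     a * (dist_prod inner z * dist_prod outer z) <=
     D * (r / kappa ^+ j) ^+ m * (b * dist_prod hs z)) ->
  (m <= size inner)%N.
Proof.
move=> r0 c0 D0 k4 kbig a0 b0 hin hout hhs lowF upF.
rewrite leqNgt; apply/negP => lm; pose l := size inner.
have k0 : 0 < kappa by lra.
pose ds := [seq nm (w - z0) | w <- inner].
have [|j jm good] := @good_radius R m r kappa ds r0 k4; first by rewrite size_map.
have kj n : 0 < kappa ^+ n by rewrite exprn_gt0.
pose s := r / kappa ^+ j.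
have s0 : 0 < s by rewrite divr_gt0.
have k1 : 1 <= kappa by lra.
have r0' := ltW r0; have c0w := ltW c0; have D0w := ltW D0; have a0w := ltW a0.
have b0w := ltW b0; have s0w := ltW s0.
have sr : s <= r by rewrite ler_pdivrMr // ler_peMr // exprn_ege1.
(* [M] exceeds both list sizes, so the far estimates hold for [outer] and [hs] on both polygons. *)
pose M := (size outer + size hs).+1.
have M0 : (0 < M)%N by [].
have oM : (size outer < M)%N by rewrite ltnS leq_addr.
have hM : (size hs < M)%N by rewrite ltnS leq_addl.
have [zr [szr nzr zrE]] := circle_points M0 (ltW r0).
have [zt [szt nzt ztE]] := circle_points M0 (ltW s0).
have rr : 0 < r <= r by rewrite r0 lexx.
have ssr : 0 < s <= r by rewrite s0.
have /andP[O1 O2] := circle_far_pow2 M0 rr zrE oM hout.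
have /andP[H1 H2] := circle_far_pow2 M0 rr zrE hM hhs.
have /andP[O3 O4] := circle_far_pow2 M0 ssr ztE oM hout.
have /andP[H3 H4] := circle_far_pow2 M0 ssr ztE hM hhs.
have I1 := circle_upper_inner szr nzr hin.
have I2 : (s ^+ M / 2) ^+ l <= \prod_(z <- zt) dist_prod inner (z0 + z).
  apply: circle_lower_inner => // w win; apply: good; exact: map_f.
pose X := (a * dist_prod outer z0) ^+ M; pose Y := (b * dist_prod hs z0) ^+ M.
have dpos ws : (forall w, w \in ws -> 2 * r <= nm (w - z0)) -> 0 < dist_prod ws z0.
  move=> h; rewrite /dist_prod big_seq; apply: prodr_gt0 => w /h; rewrite nmBC; lra.
have X0 : 0 < X by rewrite exprn_gt0 // mulr_gt0 // dpos.
have Y0 : 0 < Y by rewrite exprn_gt0 // mulr_gt0 // dpos.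
have dge ws (zs : seq C) : 0 <= \prod_(z <- zs) dist_prod ws (z0 + z).
  by apply: prodr_ge0 => z _; exact: dist_prod_ge0.
have c0' : 0 <= c * r ^+ m by rewrite mulr_ge0 ?exprn_ge0 .
have b0' : 0 <= b ^+ M by rewrite exprn_ge0.
have a0' : 0 <= a ^+ M by rewrite exprn_ge0.
have s0' : 0 <= s ^+ M / 2 by rewrite divr_ge0 // exprn_ge0.
have d0' : 0 <= D * s ^+ m by rewrite mulr_ge0 ?exprn_ge0.
have dO : 0 <= dist_prod outer z0 ^+ M by rewrite exprn_ge0 // dist_prod_ge0.
(* The hypotheses are multiplied over the vertices, here at radius r and in [E2] at radius s; the 4
   collects one factor 2 from each far list. *)
have E1 : (c * r ^+ m) ^+ M * Y <= 4 * ((3 * r) ^+ l) ^+ M * X.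
  have : \prod_(z <- zr) (c * r ^+ m * (b * dist_prod hs (z0 + z))) <=
         \prod_(z <- zr) (a * (dist_prod inner (z0 + z) * dist_prod outer (z0 + z))).
    rewrite [leLHS]big_seq [leRHS]big_seq; apply: ler_prod => z /nzr nz; apply/andP; split.
      by rewrite mulr_ge0 // mulr_ge0 // dist_prod_ge0.
    by apply: lowF; rewrite addrC addKr.
  rewrite !prod_scale big_split /= szr => A1.
  have A2 : (c * r ^+ m) ^+ M * (b ^+ M * (dist_prod hs z0 ^+ M / 2)) <=
     a ^+ M * (((3 * r) ^+ l) ^+ M * (2 * dist_prod outer z0 ^+ M)).
    apply: le_trans (le_trans A1 _).
      by rewrite ler_wpM2l ?exprn_ge0 // ler_wpM2l.
    by rewrite ler_wpM2l // ler_pM.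
  move: A2; rewrite /X /Y !exprMn; set p := c ^+ M; set q := 3 ^+ l; lra.
have E2 : (s ^+ M / 2) ^+ l * X <= 4 * (D * s ^+ m) ^+ M * Y.
  have : \prod_(z <- zt) (a * (dist_prod inner (z0 + z) * dist_prod outer (z0 + z))) <=
         \prod_(z <- zt) (D * s ^+ m * (b * dist_prod hs (z0 + z))).
    rewrite [leLHS]big_seq [leRHS]big_seq; apply: ler_prod => z /nzt nz; apply/andP; split.
      by rewrite mulr_ge0 // mulr_ge0 // dist_prod_ge0.
    by apply: upF jm _; rewrite addrC addKr.
  rewrite !prod_scale big_split /= szt => A1.
  have A2 : a ^+ M * ((s ^+ M / 2) ^+ l * (dist_prod outer z0 ^+ M / 2)) <=
     (D * s ^+ m) ^+ M * (b ^+ M * (2 * dist_prod hs z0 ^+ M)).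
    apply: le_trans (le_trans A1 _).
      by rewrite ler_wpM2l // ler_pM ?exprn_ge0 // divr_ge0.
    by rewrite ler_wpM2l ?exprn_ge0 // ler_wpM2l.
  move: A2; rewrite /X /Y; rewrite ![(_ * dist_prod _ _) ^+ M]exprMn.
  set p := (_ / 2) ^+ l; set q := (D * _) ^+ M; lra.
(* Multiplying [E1] by [E2] cancels [X * Y]. The leftover constant $16 \cdot 2^l$ is enlarged to its
   M-th power so that M-th roots can be taken. *)
have E3 : (c * r ^+ m * s ^+ l) ^+ M <= (16 * 2 ^+ l * ((3 * r) ^+ l * (D * s ^+ m))) ^+ M.
  have P0 : 0 <= ((3 * r) ^+ l) ^+ M by rewrite !exprn_ge0 // mulr_ge0 // ltW.
  have Q0 : 0 <= (D * s ^+ m) ^+ M by rewrite exprn_ge0.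
  have A1 : (c * r ^+ m) ^+ M * (s ^+ M / 2) ^+ l <= 16 * (((3 * r) ^+ l) ^+ M * (D * s ^+ m) ^+ M).
    have XY : 0 < X * Y by rewrite mulr_gt0.
    rewrite -(ler_pM2r XY); have : ((c * r ^+ m) ^+ M * Y) * ((s ^+ M / 2) ^+ l * X) <=
      (4 * ((3 * r) ^+ l) ^+ M * X) * (4 * (D * s ^+ m) ^+ M * Y).
      by apply: ler_pM => //; apply: mulr_ge0; (exact: ltW) || (by apply: exprn_ge0).
    set p := (c * _) ^+ M; set q := (s ^+ M / 2) ^+ l; set t := ((3 * r) ^+ l) ^+ M.
    set v := (D * _) ^+ M; lra.
  rewrite exprMn [in leRHS]exprMn [((3 * r) ^+ l * _) ^+ M]exprMn.
  have l2 : 0 < 2 ^+ l :> R by rewrite exprn_gt0.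
  apply: le_trans (_ : 16 * 2 ^+ l * (((3 * r) ^+ l) ^+ M * (D * s ^+ m) ^+ M) <= _).
    have -> : (s ^+ l) ^+ M = (s ^+ M / 2) ^+ l * 2 ^+ l.
      by rewrite -exprMn divfK ?pnatr_eq0 // exprAC.
    rewrite [leLHS]mulrA [leRHS]mulrAC; apply: ler_wpM2r => //; exact: ltW.
  apply: ler_wpM2r; first exact: mulr_ge0.
  have one : 1 <= 16 * 2 ^+ l :> R.
    by have : 1 <= 2 ^+ l :> R; [rewrite exprn_ege1 // ler1n | lra].
  by rewrite exprS ler_peMr ?exprn_ege1 //; apply: le_trans one.
have E4 : c * r ^+ m * s ^+ l <= 16 * 2 ^+ l * ((3 * r) ^+ l * (D * s ^+ m)).
  move: E3; rewrite ler_pXn2r ?nnegrE //; first by rewrite mulr_ge0 // exprn_ge0.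
  by rewrite mulr_ge0 ?mulr_ge0 // exprn_ge0 // mulr_ge0.
move: kbig; apply/negP; rewrite -leNgt.
have [d dE] : exists d, m = (l + d.+1)%N by exists (m - l.+1)%N; rewrite addnS -addSn subnKC.
have rs : r = s * kappa ^+ j by rewrite divfK // gt_eqF.
have tk : kappa <= (kappa ^+ j) ^+ d.+1.
  case/andP: jm => j0 _; rewrite -exprM -{1}[kappa]expr1 ler_weXn2l //.
  by rewrite muln_gt0 j0.
have A1 : c * (kappa ^+ j) ^+ d.+1 <= 16 * 6 ^+ l * D.
  have rl : 0 < r ^+ l * s ^+ m by rewrite mulr_gt0 // exprn_gt0.
  rewrite -(ler_pM2r rl); apply: le_trans (le_trans E4 _).
    have rd : r ^+ d.+1 = s ^+ d.+1 * (kappa ^+ j) ^+ d.+1 by rewrite {1}rs exprMn.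
    rewrite dE !exprD rd le_eqVlt; apply/orP; left; apply/eqP; ring.
  have -> : 6 = 2 * 3 :> R by ring.
  rewrite !exprMn le_eqVlt; apply/orP; left; apply/eqP; ring.
apply: le_trans (_ : c * (kappa ^+ j) ^+ d.+1 <= _); first by rewrite ler_pM2l.
apply: le_trans A1 _; rewrite ler_pM2r // ler_pM2l // ler_eXn2l ?ltr1n //.
exact: ltnW.
Qed.

End LocalCount.

(** * Asymptotics of $h_n(nw)$ and $q_n(nw)$ off the real axis *)

Section HermiteAsymptotics.
Variable R : realType.
Local Notation C := R[i].
Local Notation nm := (@ComplexField.Normc.normc R).
Local Notation toC := (real_complex R).
Local Notation pC p := (map_poly toC p).
Implicit Types (z w x : C).

Definition hC n x : C := (pC (hatH R n)).[x].

Lemma hC0 x : hC 0 x = 1.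
Proof. by rewrite /hC hatH0 rmorph1 hornerC. Qed.

Lemma hC1 x : hC 1 x = x.
Proof. by rewrite /hC hatH1 map_polyX hornerX. Qed.

Lemma hCSS n x : n.+2%:R * hC n.+2 x = x * hC n.+1 x - toC 2^-1 * hC n x.
Proof.
have gen (c d : R) (p0 p1 p2 : {poly R}) : c *: p2 = 'X * p1 - d *: p0 ->
    toC c * (pC p2).[x] = x * (pC p1).[x] - toC d * (pC p0).[x].
  move=> /(congr1 (fun p : {poly R} => (pC p).[x])).
  by rewrite map_polyZ rmorphB rmorphM /= map_polyX map_polyZ !hornerE.
by have := gen _ _ _ _ _ (hatHSS R n); rewrite rmorph_nat.
Qed.

(* The quotient [h_k / h_(k+1)] maps each open half-plane to the opposite one;
   the bound below is the quantitative form that the recurrence propagates. *)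
Lemma hC_herglotz k x :
  k.+1%:R * (complex.Im x * complex.Im (hC k x * conjc (hC k.+1 x))) <=
    - (complex.Im x ^+ 2 * nm (hC k x) ^+ 2).
Proof.
have sq (z : C) : nm z ^+ 2 = complex.Re z ^+ 2 + complex.Im z ^+ 2.
  by case: z => a b /=; rewrite sqr_sqrtr // addr_ge0 // sqr_ge0.
elim: k => [|k IH].
  rewrite hC0 hC1 !mul1r nm1; case: x => t s /=.
  by rewrite expr1n mulr1 mulrN -expr2.
have := hCSS k x; move: IH; rewrite !sq.
case: (hC k x) => a b; case: (hC k.+1 x) => c d; case: (hC k.+2 x) => p q; case: x => t s /=.
have -> : (k.+2%:R : C) = toC k.+2%:R by rewrite rmorph_nat.
have k1 : 0 < k.+1%:R :> R by rewrite ltr0n.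
have k2 : 0 < k.+2%:R :> R by rewrite ltr0n.
set K1 := k.+1%:R in k1 *; set K2 := k.+2%:R in k2 *.
move=> IH E.
have Ep : K2 * p - 0 * q = t * c - s * d - (2^-1 * a - 0 * b) := congr1 (@complex.Re R) E.
have Eq : K2 * q + 0 * p = t * d + s * c - (2^-1 * b + 0 * a) := congr1 (@complex.Im R) E.
have neg : s * (a * - d + b * c) <= 0.
  rewrite -(pmulr_rle0 _ k1); apply: le_trans IH _.
  by rewrite oppr_le0 mulr_ge0 ?sqr_ge0 // addr_ge0 ?sqr_ge0.
(* By the recurrence this equals $-s^2|h_{k+1}|^2$ plus half the quantity that [neg] bounds by 0. *)
have -> : K2 * (s * (c * - q + d * p)) =
    s * (d * (K2 * p - 0 * q) - c * (K2 * q + 0 * p)) by ring.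
rewrite Ep Eq; lra.
Qed.

Lemma nm_conj z : nm (conjc z) = nm z.
Proof. by case: z => a b /=; rewrite sqrrN. Qed.

(** As an imaginary part is at most the modulus, the bound [hC_herglotz] can be divided by
    $|\mathrm{Im}\,x|\,|h_k|$. *)
Lemma hC_step k x :
  `|complex.Im x| * nm (hC k x) <= k.+1%:R * nm (hC k.+1 x).
Proof.
have [h0|h0] := eqVneq (nm (hC k x)) 0; first by rewrite h0 mulr0 mulr_ge0 ?nm_ge0.
have hp : 0 < nm (hC k x) by rewrite lt_neqAle eq_sym h0 nm_ge0.
have [s0|s0] := eqVneq (complex.Im x) 0; first by rewrite s0 normr0 mul0r mulr_ge0 ?nm_ge0.
have sp : 0 < `|complex.Im x| by rewrite normr_gt0.
have := hC_herglotz k x; have := nm_Im (hC k x * conjc (hC k.+1 x)).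
rewrite nmM nm_conj -(ler_pM2l sp) -normrM => h1.
have {}h1 : - (complex.Im x * complex.Im (hC k x * conjc (hC k.+1 x))) <=
    `|complex.Im x| * (nm (hC k x) * nm (hC k.+1 x)).
  by apply: le_trans h1; rewrite -normrN ler_norm.
rewrite -[complex.Im x ^+ 2]real_normK ?num_real // => h2.
rewrite -(ler_pM2l hp) -(ler_pM2l sp).
have k1 : 0 < k.+1%:R :> R by rewrite ltr0n.
have := ler_wpM2l (ltW k1) h1; set A := complex.Im x * _ in h2 *.
lra.
Qed.

Lemma hC_gt0 k x : complex.Im x != 0 -> 0 < nm (hC k x).
Proof.
move=> s0; elim: k => [|k IH]; first by rewrite hC0 nm1.
have k1 : 0 < k.+1%:R :> R by rewrite ltr0n.
rewrite -(pmulr_rgt0 _ k1); apply: lt_le_trans (hC_step k x).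
by rewrite mulr_gt0 // normr_gt0.
Qed.

Section Scaled.
Variables d B : R.
Hypotheses (d0 : 0 < d) (B0 : 0 <= B).
Let A := d^-1.
Let A0 : 0 < A. Proof. by rewrite invr_gt0. Qed.

Lemma Im_scale n w : complex.Im (n%:R * w) = n%:R * complex.Im w.
Proof.
have -> : (n%:R : C) = toC n%:R by rewrite rmorph_nat.
by case: w => a b /=; rewrite mul0r addr0.
Qed.

Lemma nm_nat n : nm n%:R = n%:R.
Proof. by rewrite -(rmorph_nat toC) nm_real ger0_norm. Qed.

(** At x = nw the imaginary part gains a factor n, which cancels against $k+1 \le n$ in [hC_step];
    the bound is uniform in n. *)
Lemma hC_prev n k w : (0 < n)%N -> (k < n)%N -> d <= `|complex.Im w| ->
  nm (hC k (n%:R * w)) <= A * nm (hC k.+1 (n%:R * w)).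
Proof.
move=> n0 kn dw; set x := n%:R * w.
have nR : 0 < n%:R :> R by rewrite ltr0n.
have := hC_step k x; rewrite Im_scale normrM ger0_norm // => h.
rewrite /A ler_pdivlMl // -(ler_pM2l nR) mulrA.
apply: le_trans (_ : n%:R * `|complex.Im w| * nm (hC k x) <= _).
  by rewrite ler_wpM2r ?nm_ge0 // ler_wpM2l.
by apply: le_trans h _; rewrite ler_wpM2r ?nm_ge0 // ler_nat.
Qed.

Lemma hC_down n j w : (j <= n)%N -> d <= `|complex.Im w| ->
  nm (hC (n - j) (n%:R * w)) <= A ^+ j * nm (hC n (n%:R * w)).
Proof.
move=> + dw; elim: j => [|j IH] jn; first by rewrite subn0 expr0 mul1r.
have n0 : (0 < n)%N by apply: leq_ltn_trans jn.
have lt : (n - j.+1 < n)%N by rewrite ltn_subrL.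
have := hC_prev n0 lt dw; rewrite subnSK // => h.
apply: le_trans h _; rewrite exprS -mulrA ler_wpM2l ?IH //; [exact: ltW | exact: ltnW].
Qed.

(** With k+2 = n-j, passing from j to j+1 adds $w^j(w h_{k+1} - h_{k+2})$. By the recurrence, n
    times the bracket is $h_k/2 - j h_{k+2}$, which is bounded by a constant times $|h_{k+2}|$; so
    each step costs a relative error O(1/n). *)
Lemma hC_ratio j : exists2 Cj : R, 0 <= Cj & forall n w, (j.+1 < n)%N ->
  d <= `|complex.Im w| -> nm w <= B ->
  n%:R * nm (w ^+ j * hC (n - j) (n%:R * w) - hC n (n%:R * w)) <= Cj * nm (hC n (n%:R * w)).
Proof.
elim: j => [|j [Cj Cj0 IH]].
  exists 0 => // n w _ _ _; by rewrite subn0 expr0 mul1r subrr nm0 mulr0 mul0r.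
have A0w := ltW A0.
(* [B ^+ j] bounds $|w|^j$, [A ^+ 2] and j bound the two terms of the recurrence, and [A ^+ j] leads
   from $h_{n-j}$ back to $h_n$. *)
exists (Cj + B ^+ j * (A ^+ 2 + j%:R) * A ^+ j).
  by rewrite addr_ge0 // !mulr_ge0 ?exprn_ge0 // addr_ge0 // exprn_ge0.
move=> n w jn dw wB; set x := n%:R * w.
have nR : 0 < n%:R :> R by rewrite ltr0n (leq_ltn_trans _ jn).
have [k kE] : exists k, (n - j)%N = k.+2 by exists (n - j).-2; lia.
have k1 : (n - j.+1)%N = k.+1 by lia.
have {IH} := IH n w (ltnW jn) dw wB; rewrite k1 kE -/x => IH.
have h1 : nm (hC k x) <= A * nm (hC k.+1 x) by apply: hC_prev => //; lia.
have h2 : nm (hC k.+1 x) <= A * nm (hC k.+2 x) by apply: hC_prev => //; lia.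
have h3 : nm (hC k.+2 x) <= A ^+ j * nm (hC n x).
  by rewrite -kE; apply: hC_down => //; lia.
have E : n%:R * (w * hC k.+1 x - hC k.+2 x) = toC 2^-1 * hC k x - j%:R * hC k.+2 x.
  have nE : n%:R = k.+2%:R + j%:R :> C by rewrite -natrD -kE subnK //; lia.
  have rec : k.+2%:R * hC k.+2 x = n%:R * w * hC k.+1 x - toC 2^-1 * hC k x := hCSS k x.
  rewrite mulrBr mulrA.
  have -> : n%:R * w * hC k.+1 x = k.+2%:R * hC k.+2 x + toC 2^-1 * hC k x by rewrite rec subrK.
  rewrite nE; ring.
have h4 : n%:R * nm (w * hC k.+1 x - hC k.+2 x) <= (A ^+ 2 + j%:R) * nm (hC k.+2 x).
  rewrite -nm_nat -nmM E; apply: le_trans (nmD _ _) _; rewrite nmN !nmM nm_nat nm_real.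
  have h5 : nm (hC k x) <= A ^+ 2 * nm (hC k.+2 x).
    by apply: le_trans h1 _; rewrite expr2 -mulrA ler_wpM2l.
  rewrite mulrDl lerD2r; apply: le_trans _ h5; rewrite ger0_norm ?invr_ge0 //.
  rewrite ler_piMl ?nm_ge0 // invf_le1 // ler1n.
  by [].
have -> : w ^+ j.+1 * hC k.+1 x - hC n x =
   (w ^+ j * hC k.+2 x - hC n x) + w ^+ j * (w * hC k.+1 x - hC k.+2 x).
  by rewrite exprSr; ring.
apply: le_trans (_ : n%:R * (nm (w ^+ j * hC k.+2 x - hC n x) +
    nm (w ^+ j * (w * hC k.+1 x - hC k.+2 x))) <= _).
  by rewrite ler_pM2l // nmD.
rewrite mulrDr [in leRHS]mulrDl lerD // nmM nmX mulrCA -!mulrA.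
apply: ler_pM; rewrite ?exprn_ge0 ?nm_ge0 ?mulr_ge0 ?nm_ge0 //.
  by rewrite lerXn2r ?nnegrE ?nm_ge0.
apply: le_trans h4 _; rewrite ler_wpM2l // addr_ge0 // exprn_ge0 //.
Qed.

Definition qC K (gamma : nat -> R) n x : C := (pC (hermite_q K gamma n)).[x].
Definition PC K (gamma : nat -> R) x : C := (pC (gamma_P K gamma)).[x].

Lemma qC_sum K gamma n x : (K <= n)%N ->
  qC K gamma n x = \sum_(j < K.+1) toC (gamma j) * hC (n - j) x.
Proof.
move=> Kn; rewrite /qC /hermite_q rmorph_sum /= horner_sum; apply: eq_bigr => j _.
by rewrite (leq_trans _ Kn) -1?ltnS // map_polyZ hornerZ.
Qed.

Lemma PC_sum K gamma x : PC K gamma x = \sum_(j < K.+1) toC (gamma j) * x ^+ (K - j).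
Proof.
rewrite /PC /gamma_P rmorph_sum /= horner_sum; apply: eq_bigr => j _.
by rewrite map_polyZ /= map_polyXn !hornerE.
Qed.

(** The estimates [hC_ratio], weighted by $\gamma_j w^{K-j}$ and summed, turn the $h_{n-j}$ into
    $h_n P(w)$. *)
Lemma qC_ratio K gamma : exists2 M : R, 0 <= M & forall n w, (K.+1 < n)%N ->
  d <= `|complex.Im w| -> nm w <= B ->
  n%:R * nm (w ^+ K * qC K gamma n (n%:R * w) - hC n (n%:R * w) * PC K gamma w) <=
    M * nm (hC n (n%:R * w)).
Proof.
have H (j : nat) : exists cj : R, 0 <= cj /\ forall n w, (j.+1 < n)%N ->
    d <= `|complex.Im w| -> nm w <= B ->
    n%:R * nm (w ^+ j * hC (n - j) (n%:R * w) - hC n (n%:R * w)) <= cj * nm (hC n (n%:R * w)).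
  by have [Cj] := hC_ratio j; exists Cj.
have [c cP] := boolp.choice H.
exists (\sum_(j < K.+1) `|gamma j| * (B ^+ (K - j) * c j)).
  apply: sumr_ge0 => j _; have [cj _] := cP j.
  by rewrite !mulr_ge0 // exprn_ge0.
move=> n w Kn dw wB; set x := n%:R * w.
have -> : w ^+ K * qC K gamma n x - hC n x * PC K gamma w =
    \sum_(j < K.+1) toC (gamma j) * w ^+ (K - j) * (w ^+ j * hC (n - j) x - hC n x).
  rewrite qC_sum; last by lia.
  rewrite PC_sum !mulr_sumr -sumrB; apply: eq_bigr => j _.
  have -> : w ^+ K = w ^+ (K - j) * w ^+ j by rewrite -exprD subnK // -ltnS.
  ring.
apply: le_trans (_ : \sum_(j < K.+1) n%:R *
   nm (toC (gamma j) * w ^+ (K - j) * (w ^+ j * hC (n - j) x - hC n x)) <= _).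
  by rewrite -mulr_sumr ler_wpM2l // nm_sum.
rewrite mulr_suml; apply: ler_sum => j _.
have [cj /(_ n w) cPj] := cP j; rewrite !nmM nm_real nmX.
have jn : (j.+1 < n)%N by apply: leq_trans Kn; rewrite !ltnS -ltnS.
rewrite mulrCA -[leLHS]mulrA -[leRHS]mulrA ler_wpM2l // mulrCA.
rewrite [leLHS]mulrCA -[leRHS]mulrA ler_pM ?exprn_ge0 ?nm_ge0 ?mulr_ge0 ?nm_ge0 //.
  by rewrite lerXn2r ?nnegrE ?nm_ge0.
exact: cPj.
Qed.

End Scaled.
End HermiteAsymptotics.

(** * The lower bound on non-real zeros *)

Section CountNonreal.
Variable R : realType.
Local Notation C := R[i].
Local Notation nm := (@ComplexField.Normc.normc R).
Local Notation toC := (real_complex R).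
Local Notation pC p := (map_poly toC p).
Implicit Types (z w x : C).

Lemma nm_pC (p : {poly R}) w : nm (pC p).[w] = `|lead_coef p| * dist_prod (croots p) w.
Proof.
rewrite crootsE hornerZ nmM nm_real horner_prod nm_prod; congr (_ * _).
by apply: eq_bigr => z _; rewrite !hornerE.
Qed.

Lemma nm_pC_scaled (p : {poly R}) n w : (0 < n)%N ->
  nm (pC p).[n%:R * w] = `|lead_coef p| * n%:R ^+ size (croots p) *
    dist_prod [seq n%:R^-1 * y | y <- croots p] w.
Proof.
move=> n0; rewrite nm_pC -mulrA; congr (_ * _); rewrite /dist_prod big_map -prod_scale.
have nz : n%:R != 0 :> C by rewrite pnatr_eq0 -lt0n.
apply: eq_bigr => y _; rewrite -nm_nat -nmM mulrBr mulrA divff // mul1r.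
by [].
Qed.

Lemma nm_bounded (s : seq C) : exists2 Z, 0 <= Z & forall z, z \in s -> nm z <= Z.
Proof.
elim: s => [|z s [Z Z0 IH]]; first by exists 0.
exists (nm z + Z); first by rewrite addr_ge0 ?nm_ge0.
move=> y; rewrite inE => /orP[/eqP ->|/IH h]; first by rewrite lerDl.
by apply: le_trans h _; rewrite lerDr nm_ge0.
Qed.

(** The factors at [z0] give [rho] exactly; each other one is at least 4r - r and at most $|w| +
    |z|$. *)
Lemma dist_prod_near (s : seq C) z0 w r Z : 0 < r -> nm (w - z0) <= r ->
  (forall z, z \in s -> z != z0 -> 4 * r <= nm (z - z0)) ->
  (forall z, z \in s -> nm z <= Z) -> 0 <= Z ->
  let k := count (predC1 z0) s in let rho := nm (w - z0) ^+ count_mem z0 s in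
  rho * (3 * r) ^+ k <= dist_prod s w <= rho * (nm z0 + r + Z) ^+ k.
Proof.
move=> r0 wr sep bnd Z0 /=; elim: s sep bnd => [|z s IH] sep bnd.
  by rewrite /dist_prod big_nil /= !expr0 mulr1 lexx.
have /andP[l1 l2] := IH (fun z zs => sep z (mem_behead (s := _ :: _) zs))
                        (fun z zs => bnd z (mem_behead (s := _ :: _) zs)).
have r3 : 0 <= 3 * r by rewrite mulr_ge0 // ltW.
have zr : 0 <= nm z0 + r + Z by rewrite !addr_ge0 ?nm_ge0 // ltW.
rewrite /dist_prod big_cons -/(dist_prod s w) /=; case: eqVneq => [->|zz] /=.
  by rewrite add1n add0n exprS -!mulrA !ler_wpM2l ?nm_ge0.
rewrite add1n add0n !exprS.
apply/andP; split; [rewrite [leLHS]mulrCA | rewrite [leRHS]mulrCA]; apply: ler_pM => //.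
- by rewrite mulr_ge0 // exprn_ge0 ?nm_ge0.
- have := sep z (mem_head _ _) zz; have := nmD (z - w) (w - z0).
  rewrite [z - w + _]addrA subrK [nm (z - w)]nmBC => h1 h2.
  clear l1 l2; lra.
- exact: nm_ge0.
- exact: dist_prod_ge0.
- have := bnd z (mem_head _ _); have := nmD (w - z0) z0; have := nmD w (- z).
  rewrite subrK nmN; clear l1 l2; lra.
Qed.

Lemma hC_roots_real n y : y \in croots (hatH R n) -> complex.Im y = 0.
Proof.
move=> yin; apply/eqP/negPn/negP => /(hC_gt0 n); rewrite /hC nm_pC.
by rewrite /dist_prod (big_rem y) //= subrr nm0 mul0r mulr0 ltxx.
Qed.

Lemma archi_nat (a : R) : exists n1 : nat, forall n, (n1 <= n)%N -> a <= n%:R.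
Proof.
exists (Num.truncn `|a|).+1 => n n1; apply: le_trans (ler_norm a) _.
apply: le_trans (ltW (truncnS_gt _)) _; by rewrite ler_nat.
Qed.

Lemma near_nonreal r z0 w : 4 * r <= `|complex.Im z0| -> nm (w - z0) <= r ->
  [/\ 3 * r <= `|complex.Im w|, nm w <= nm z0 + r & 3 * r <= nm w].
Proof.
move=> rI wr; have h1 : 3 * r <= `|complex.Im w|.
  have : `|complex.Im z0| <= `|complex.Im w| + `|complex.Im (w - z0)|.
    case: (w) (z0) => [u v] [s t] /=; have := ler_normB v (v - t).
    by rewrite opprB addrC subrK.
  have := nm_Im (w - z0); lra.
split=> //; first by have := nmD (w - z0) z0; rewrite subrK; lra.
by apply: le_trans h1 (nm_Im _).
Qed.

Section Near.
Variables (K : nat) (gamma : nat -> R).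
Hypothesis g0 : gamma 0%N = 1.
Let P := gamma_P K gamma.
Local Notation q := (hermite_q K gamma).

Lemma coefK_gamma_P : P`_K = 1.
Proof. by have := coef_gamma_P gamma (leq0n K); rewrite subn0 g0. Qed.

Lemma lead_gamma_P : lead_coef P = 1.
Proof. by rewrite lead_coefE size_gamma_P //= coefK_gamma_P. Qed.

Lemma size_hermite_q n : size (q n) = n.+1.
Proof. by rewrite hermite_q_comb size_comb // coefK_gamma_P oner_neq0. Qed.

(** [local_roots] compares $q_n(nw)$ with $h_n(nw)$, whose zeros are real and hence far from [z0].
    By [qC_ratio] the quotient is close to $P(w)/w^K$, which is of order $|w-z_0|^m$. *)
Lemma near_count z0 r : 0 < r -> 4 * r <= `|complex.Im z0| ->
  (forall z, z \in croots P -> z != z0 -> 4 * r <= nm (z - z0)) ->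
  exists n1, forall n, (n1 <= n)%N ->
   (count_mem z0 (croots P) <= count (fun y => (nm (n%:R^-1 * y - z0) < 2 * r)%R) (croots (q n)))%N.
Proof.
move=> r0 rI sep; have r0w := ltW r0.
pose m := count_mem z0 (croots P); pose k := count (predC1 z0) (croots P).
have [Z Z0 bnd] := nm_bounded (croots P).
pose B := nm z0 + r.
have B0 : 0 < B by rewrite ltr_wpDl ?nm_ge0.
have d0 : 0 < 3 * r by rewrite mulr_gt0.
have [M M0 ratio] := qC_ratio d0 (ltW B0) K gamma.
have [c1 c1E] : exists c1, c1 = (3 * r) ^+ k by exists ((3 * r) ^+ k).
have [D1 D1E] : exists D1, D1 = (B + Z) ^+ k by exists ((B + Z) ^+ k).
have c10 : 0 < c1 by rewrite c1E exprn_gt0.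
have D10 : 0 < D1 by rewrite D1E exprn_gt0 // ltr_wpDr.
have BK : 0 < B ^+ K by rewrite exprn_gt0.
have rK : 0 < (3 * r) ^+ K by rewrite exprn_gt0.
(* Half the lower bound on $|P|$ and twice the upper one absorb the error term; $|w|^K$ lies between
   $(3r)^K$ and $B^K$. *)
have [c cE] : exists c, c = c1 / 2 / B ^+ K by exists (c1 / 2 / B ^+ K).
have [D DE] : exists D, D = 2 * D1 / (3 * r) ^+ K by exists (2 * D1 / (3 * r) ^+ K).
have c0 : 0 < c by rewrite cE !divr_gt0.
have D0 : 0 < D by rewrite DE divr_gt0 // mulr_gt0.
have [kappa k4 kbig] : exists2 kappa, 4 <= kappa & 16 * 6 ^+ m * D < c * kappa.
  have kp : 0 <= 16 * 6 ^+ m * D by rewrite mulr_ge0 ?(ltW D0) // mulr_ge0 ?exprn_ge0.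
  exists (4 + 16 * 6 ^+ m * D / c); first by rewrite lerDl divr_ge0 // ltW.
  by rewrite mulrDr [c * (_ / c)]mulrC divfK ?gt_eqF // ltrDr mulr_gt0.
have k1 : 1 <= kappa by apply: le_trans k4; rewrite ler1n.
have k0 : 0 < kappa by apply: lt_le_trans k1.
have smin : 0 < (r / kappa ^+ m) ^+ m by rewrite exprn_gt0 // divr_gt0 // exprn_gt0.
have rm : 0 < r ^+ m by rewrite exprn_gt0.
(* From these indices on, the error M/n is at most half the lower bound on $|P|$ at radius r, and at
   most the upper bound at the smallest radius $r/\kappa^m$. *)
have [n1 n1P] := archi_nat (M / (c1 / 2 * r ^+ m)).
have [n2 n2P] := archi_nat (M / (D1 * (r / kappa ^+ m) ^+ m)).
exists (n1 + n2 + K.+2)%N => n nn.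
have nK : (K.+1 < n)%N := leq_trans (leq_addl _ _) nn.
have n0 : (0 < n)%N := leq_ltn_trans (leq0n _) nK.
have nn1 : (n1 <= n)%N := leq_trans (leq_trans (leq_addr _ _) (leq_addr _ _)) nn.
have nn2 : (n2 <= n)%N := leq_trans (leq_trans (leq_addl _ _) (leq_addr _ _)) nn.
have nR : 0 < n%:R :> R by rewrite ltr0n.
have A1 : M <= n%:R * (c1 / 2 * r ^+ m).
  by rewrite -ler_pdivrMr ?n1P // mulr_gt0 // divr_gt0.
have A2 : M <= n%:R * (D1 * (r / kappa ^+ m) ^+ m).
  by rewrite -ler_pdivrMr ?n2P // mulr_gt0.
pose ws := [seq n%:R^-1 * y | y <- croots (q n)].
pose hs := [seq n%:R^-1 * y | y <- croots (hatH R n)].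
pose near := fun y => nm (y - z0) < 2 * r.
pose inner := filter near ws; pose outer := filter (predC near) ws.
have -> : count (fun y => nm (n%:R^-1 * y - z0) < 2 * r) (croots (q n)) = size inner.
  by rewrite size_filter count_map.
have splitws w : dist_prod ws w = dist_prod inner w * dist_prod outer w.
  by rewrite /dist_prod /inner /outer !big_filter (bigID near).
have sq := size_hermite_q n.
pose a : R := `|lead_coef (q n)| * n%:R ^+ size (croots (q n)).
pose b : R := `|lead_coef (hatH R n)| * n%:R ^+ size (croots (hatH R n)).
have a0 : 0 < a.
  by rewrite mulr_gt0 ?exprn_gt0 // normr_gt0 lead_coef_eq0 -size_poly_eq0 sq.
have b0 : 0 < b.
  by rewrite mulr_gt0 ?exprn_gt0 // normr_gt0 lead_coef_eq0 -size_poly_eq0 size_hatH.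
have qE w : a * (dist_prod inner w * dist_prod outer w) = nm (qC K gamma n (n%:R * w)).
  by rewrite -splitws /qC nm_pC_scaled.
have hE w : b * dist_prod hs w = nm (hC n (n%:R * w)) by rewrite /hC nm_pC_scaled.
have PE w : nm (PC K gamma w) = dist_prod (croots P) w.
  by rewrite /PC nm_pC lead_gamma_P normr1 mul1r.
have reg w : nm (w - z0) <= r -> [/\ 3 * r <= `|complex.Im w|, nm w <= B & 3 * r <= nm w].
  exact: near_nonreal.
apply: (local_roots (z0 := z0) (outer := outer) (hs := hs) r0 c0 D0 k4 kbig a0 b0).
- by move=> w; rewrite mem_filter => /andP[h _]; exact: ltW.
- by move=> w; rewrite mem_filter => /andP[/= + _]; rewrite /near -leNgt.
- move=> w /mapP[y /hC_roots_real yI ->].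
  have := nm_Im (n%:R^-1 * y - z0).
  have -> : complex.Im (n%:R^-1 * y - z0) = - complex.Im z0.
    have -> : n%:R^-1 = toC n%:R^-1 :> C by rewrite fmorphV rmorph_nat.
    by case: (y) (z0) yI => [u v] [s t] /= ->; rewrite mulr0 mul0r addr0 sub0r.
  rewrite normrN => h; apply: le_trans (le_trans rI h); rewrite ler_pM2r // ler_nat.
  by [].
- move=> w wr; have [d1 d2 d3] : [/\ 3 * r <= `|complex.Im w|, nm w <= B & 3 * r <= nm w].
    by apply: reg; rewrite wr.
  rewrite qE hE; set h := nm (hC n _).
  have h0 : 0 <= h by exact: nm_ge0.
  have := ratio n w nK d1 d2; rewrite -/h => rat.
  have : (r ^+ m * c1) <= nm (PC K gamma w).
    have := @dist_prod_near (croots P) z0 w r Z r0; rewrite wr => /(_ (lexx r) sep bnd Z0).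
    by rewrite PE c1E => /andP[].
  move=> lowP.
  set e := nm (w ^+ K * _ - _) in rat.
  have eh : e <= c1 / 2 * r ^+ m * h.
    rewrite -(ler_pM2l nR) (le_trans rat) // mulrA ler_wpM2r //.
  have E1 : h * nm (PC K gamma w) <= nm w ^+ K * nm (qC K gamma n (n%:R * w)) + e.
    rewrite -nmX -!nmM /e [X in _ + X]nmBC; apply: le_trans (nmD _ _).
    by rewrite addrC subrK.
  have E2 : h * (r ^+ m * c1) <= h * nm (PC K gamma w) by rewrite ler_wpM2l.
  have E3 : nm w ^+ K * nm (qC K gamma n (n%:R * w)) <= B ^+ K * nm (qC K gamma n (n%:R * w)).
    by rewrite ler_wpM2r ?nm_ge0 // lerXn2r ?nnegrE ?nm_ge0 // ltW.
  rewrite -(ler_pM2l BK) -/m; apply: le_trans E3.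
  have -> : B ^+ K * (c * r ^+ m * h) = c1 / 2 * r ^+ m * h.
    by rewrite !mulrA [B ^+ K * c]mulrC cE divfK // gt_eqF.
  move: E1 E2 eh; move: (nm w ^+ K * _) (h * nm _) (r ^+ m) => p t v; clear; lra.
- move=> w j jm wr; set rho := r / kappa ^+ j in wr *.
  have kj i : 0 < kappa ^+ i by rewrite exprn_gt0.
  have rho0 : 0 < rho by rewrite divr_gt0.
  have rhor : rho <= r by rewrite ler_pdivrMr // ler_peMr // exprn_ege1.
  have rhom : (r / kappa ^+ m) ^+ m <= rho ^+ m.
    rewrite lerXn2r ?nnegrE ?(ltW rho0) //; first by rewrite divr_ge0 // ltW.
    rewrite /rho ler_pM2l // lef_pV2 ?posrE // ler_weXn2l //.
    by case/andP: jm.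
  have [d1 d2 d3] : [/\ 3 * r <= `|complex.Im w|, nm w <= B & 3 * r <= nm w].
    by apply: reg; rewrite wr.
  rewrite qE hE; set h := nm (hC n _).
  have h0 : 0 <= h by exact: nm_ge0.
  have := ratio n w nK d1 d2; rewrite -/h => rat.
  have upP : nm (PC K gamma w) <= rho ^+ m * D1.
    have := @dist_prod_near (croots P) z0 w r Z r0; rewrite wr => /(_ rhor sep bnd Z0).
    by rewrite PE D1E => /andP[].
  set e := nm (w ^+ K * _ - _) in rat.
  have eh : e <= D1 * rho ^+ m * h.
    rewrite -(ler_pM2l nR) (le_trans rat) // mulrA ler_wpM2r //.
    by apply: le_trans A2 _; rewrite ler_pM2l // ler_pM2l.
  have E1 : nm w ^+ K * nm (qC K gamma n (n%:R * w)) <= h * nm (PC K gamma w) + e.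
    rewrite -nmX -!nmM /e; apply: le_trans (nmD _ _).
    by rewrite addrC subrK.
  have E2 : h * nm (PC K gamma w) <= h * (rho ^+ m * D1) by rewrite ler_wpM2l.
  have E3 : (3 * r) ^+ K * nm (qC K gamma n (n%:R * w)) <= nm w ^+ K * nm (qC K gamma n (n%:R * w)).
    by rewrite ler_wpM2r ?nm_ge0 // lerXn2r ?nnegrE ?nm_ge0 // ltW.
  rewrite -(ler_pM2l rK); apply: le_trans E3 _.
  have -> : (3 * r) ^+ K * (D * rho ^+ m * h) = 2 * D1 * rho ^+ m * h.
    by rewrite !mulrA [(3 * r) ^+ K * D]mulrC DE divfK // gt_eqF.
  move: E1 E2 eh; move: (nm w ^+ K * _) (h * nm _) (rho ^+ m) => p t v; clear; lra.
Qed.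

Lemma separation_radius (s : seq C) : exists2 r : R, 0 < r &
  (forall z, z \in s -> complex.Im z != 0 -> 4 * r <= `|complex.Im z|) /\
  (forall y z, y \in s -> z \in s -> y != z -> 4 * r <= nm (y - z)).
Proof.
pose L := [seq `|complex.Im z| | z <- s] ++ [seq nm (y - z) | y <- s, z <- s].
have [r r0 rL] : exists2 r : R, 0 < r & forall a, a \in L -> 0 < a -> 4 * r <= a.
  elim: L => [|a L [r r0 IH]]; first by exists 1.
  have [a0|a0] := ltP 0 a; last first.
    exists r => // b; rewrite inE => /orP[/eqP ->|/IH //]; by rewrite ltNge a0.
  exists (Num.min r (a / 4)); first by rewrite lt_min r0 divr_gt0.
  move=> b; rewrite inE => /orP[/eqP -> _|/IH h /h].
    by rewrite mulrC -ler_pdivlMr // ge_min lexx orbT.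
  by apply: le_trans; rewrite ler_pM2l // ge_min lexx.
exists r => //; split=> [z zs z0|y z ys zs yz]; apply: rL.
- by rewrite mem_cat; apply/orP; left; apply/mapP; exists z.
- by rewrite normr_gt0.
- by rewrite mem_cat; apply/orP; right; apply/allpairsP; exists (y, z).
- by rewrite nm_gt0 subr_eq0.
Qed.

Lemma eventually_all (T : eqType) (s : seq T) (Q : T -> nat -> Prop) :
  (forall z : T, z \in s -> exists n1, forall n, (n1 <= n)%N -> Q z n) ->
  exists n1, forall n, (n1 <= n)%N -> forall z : T, z \in s -> Q z n.
Proof.
elim: s => [|z s IH] h; first by exists 0%N.
have [|n1 H1] := IH; first by move=> y ys; apply: h; rewrite inE ys orbT.
have [n2 H2] := h z (mem_head _ _).
exists (n1 + n2)%N => n nn y; rewrite inE => /orP[/eqP ->|ys]; [apply: H2; lia|].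
by apply: H1 => //; lia.
Qed.

(** The disks of radius 2r around the distinct non-real zeros of [P] are disjoint and avoid the real
    axis, so the local counts of [near_count] add up and count only non-real zeros. *)
Lemma n_nonreal_ge : exists n, (n_nonreal P <= n_nonreal (q n))%N.
Proof.
have [r r0 [rI rD]] := separation_radius (croots P).
pose L := undup [seq z <- croots P | complex.Im z != 0].
have Lin z : z \in L -> complex.Im z != 0 /\ z \in croots P.
  by rewrite mem_undup mem_filter => /andP[].
have [|n1 H] := @eventually_all _ L (fun z n =>
  (count_mem z (croots P) <= count (fun y => (nm (n%:R^-1 * y - z) < 2 * r)%R) (croots (q n)))%N).
  move=> z /Lin [zI zP]; apply: near_count => //; first exact: rI.
  by move=> y yP; apply: rD.
exists n1; have {}H := H n1 (leqnn _).
have countE (s : seq C) (p : pred C) : count p s = (\sum_(y <- s) p y)%N.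
  by rewrite -sum1_count big_mkcond; apply: eq_bigr => y _; case: (p y).
apply: (@leq_trans (\sum_(z <- L) count_mem z (croots P))).
  under eq_bigr do rewrite countE.
  rewrite exchange_big /n_nonreal countE big_seq [X in (_ <= X)%N]big_seq.
  apply: leq_sum => y yP; case: (boolP (_ != 0)) => // yI.
  have yL : y \in L by rewrite mem_undup mem_filter yI.
  by rewrite (big_rem y) //= eqxx.
apply: (@leq_trans (\sum_(z <- L) count (fun y => (nm (n1%:R^-1 * y - z) < 2 * r)%R) (croots (q n1)))).
  by rewrite big_seq [X in (_ <= X)%N]big_seq; apply: leq_sum.
under eq_bigr do rewrite countE.
rewrite exchange_big /n_nonreal countE; apply: leq_sum => y _ /=.
rewrite -(countE L (fun z => nm (n1%:R^-1 * y - z) < 2 * r)).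
have [/hasP [z zL zn]|] := boolP (has (fun z => nm (n1%:R^-1 * y - z) < 2 * r) L); last first.
  by rewrite has_count lt0n negbK => /eqP ->.
have [zI zP] := Lin z zL.
have -> : complex.Im y != 0.
  apply: contraTneq zn => yI; rewrite -leNgt.
  have := nm_Im (n1%:R^-1 * y - z).
  have -> : complex.Im (n1%:R^-1 * y - z) = - complex.Im z.
    have -> : n1%:R^-1 = toC n1%:R^-1 :> C by rewrite fmorphV rmorph_nat.
    by case: (y) (z) yI => [u v] [a b] /= ->; rewrite mulr0 mul0r addr0 sub0r.
  have := rI z zP zI; rewrite normrN; lra.
(* Distinct centres are at least 4r apart, so no other centre is within 2r of the rescaled zero. *)
rewrite -[X in (_ <= X)%N]/1%N.
rewrite (@eq_in_count _ _ (pred1 z)) ?count_uniq_mem ?undup_uniq ?leq_b1 // => z' z'L /=.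
apply/idP/eqP => [z'n|-> //]; apply/eqP; apply: contraTT z'n => ne; rewrite -leNgt.
have [_ z'P] := Lin z' z'L.
have := rD z' z z'P zP ne; have := nmD (z' - n1%:R^-1 * y) (n1%:R^-1 * y - z).
rewrite addrA subrK [nm (z' - _ * _)]nmBC; lra.
Qed.

End Near.
End CountNonreal.

(** * Stabilization, simplicity and interlacing for $q_n$ *)

Section Final.
Variables (R : realType) (K : nat) (gamma : nat -> R).
Hypothesis g0 : gamma 0%N = 1.
Local Notation q := (hermite_q K gamma).
Local Notation N := (n_nonreal (gamma_P K gamma)).

Lemma q_neq0 n : q n != 0.
Proof. by rewrite -size_poly_eq0 size_hermite_q. Qed.

Lemma deriv_q n : (q n.+1)^`() = q n.
Proof. by rewrite !hermite_q_comb comb_deriv. Qed.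

Lemma n_nonreal_q_le n : (n_nonreal (q n) <= N)%N.
Proof. by rewrite hermite_q_comb n_nonreal_comb // size_gamma_P. Qed.

Lemma n_nonreal_q_homo m n : (m <= n)%N -> (n_nonreal (q m) <= n_nonreal (q n))%N.
Proof.
move=> /subnK <-; elim: (n - m)%N => //= k IH; apply: leq_trans IH _.
by rewrite addSn -[q (k + m)]deriv_q n_nonreal_deriv // deriv_q q_neq0.
Qed.

(** Otherwise the generating series of the $q_m(x)$ is the polynomial [A], equal to [G] times the
    series of the $h_m(x)$, against [gauss_series_not_poly]. *)
Lemma q_no_common_zero x n : exists2 m, (n <= m)%N & ~~ root (q m) x.
Proof.
pose A := \poly_(m < n) (q m).[x]; pose G := \poly_(j < K.+1) gamma j.
have [[m /andP[nm qm]]|all0] := boolp.pselect (exists m, (n <= m)%N && ~~ root (q m) x).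
  by exists m.
have AE m : A`_m = (q m).[x].
  rewrite coef_poly; case: ltnP => // nm; apply/esym/eqP/negPn/negP => qm.
  by apply: all0; exists m; rewrite nm.
have qE m : (q m).[x] = \sum_(j < m.+1) G`_j * (hatH R (m - j)).[x].
  rewrite /hermite_q horner_sum.
  rewrite (big_ord_widen (K.+1 + m.+1) (fun j =>
    (gamma j *: (if (j <= m)%N then hatH R (m - j) else 0)).[x])) ?leq_addr //.
  rewrite (big_ord_widen (K.+1 + m.+1) (fun j => G`_j * (hatH R (m - j)).[x])) ?leq_addl //.
  rewrite big_mkcond [RHS]big_mkcond; apply: eq_bigr => j _ /=.
  rewrite coef_poly hornerZ !ltnS; case: (leqP j K) => _; case: (leqP j m) => _;
    by rewrite ?mul0r ?horner0 ?mulr0.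
have G0 : G`_0 = 1 by rewrite coef_poly g0.
exfalso; apply: (@gauss_series_not_poly R (fun m => (hatH R m).[x]) x A G).
- by rewrite hatH1 hatH0 hornerX hornerC mulr1.
- by move=> m; have /(congr1 (horner^~ x)) := hatHSS R m; rewrite !hornerE.
- by move=> m; rewrite AE qE.
- apply: contra_eq_neq (_ : A`_0 = 1) => [->|]; first by rewrite coef0 eq_sym oner_neq0.
  by rewrite AE qE big_ord1 G0 hatH0 hornerC mulr1.
- by apply: contra_eq_neq G0 => ->; rewrite coef0 eq_sym oner_neq0.
Qed.

Section Stable.
Variable n : nat.
Hypothesis stable : forall m, (n <= m)%N -> n_nonreal (q m) = N.

(** The degree changes by one while the number of non-real zeros stays N. *)
Lemma tight_q m : (n <= m)%N -> n_real (q m.+1) = (n_real (q m.+1)^`()).+1.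
Proof.
move=> nm; rewrite deriv_q.
have := n_realD (q_neq0 m.+1); have := n_realD (q_neq0 m).
rewrite !size_hermite_q // (stable nm) (stable (leqW nm)).
by move=> /= E1 E2; apply/eqP; rewrite -(eqn_add2r N) E2 addSn E1.
Qed.

Lemma simple_q m : (n <= m)%N -> simple_real_zeros (q m).
Proof.
move=> nm x rx; apply/negP => rdx.
(* A double zero of $q_{k+m}$ is a zero of $q_{k+m+1}$ by [tight_double_root], and a double one
   because $q_{k+m+1}' = q_{k+m}$. *)
have both k : root (q (k + m)) x && root (q (k + m))^`() x.
  elim: k => [|k /andP[r1 r2]]; first by rewrite rx rdx.
  have t := tight_q (leq_trans nm (leq_addl k m)).
  rewrite addSn deriv_q r1 andbT; apply: (tight_double_root _ t); by rewrite deriv_q ?q_neq0.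
have [k mk] := q_no_common_zero x m.
by have /andP[+ _] := both (k - m)%N; rewrite subnK // => ->.
Qed.

Lemma interlace_q m : (n <= m)%N -> interlace (root (q m.+1)) (root (q m)).
Proof.
move=> nm; rewrite -[X in interlace _ (root X)]deriv_q; apply: tight_interlace.
- by rewrite deriv_q q_neq0.
- exact: tight_q.
- by apply: simple_q; exact: leqW.
Qed.

End Stable.
End Final.

Unset Implicit Arguments.

Theorem theorem1p3 (R : realType) (K : nat) (gamma : nat -> R) :
  (0 < K)%N -> gamma 0%N = 1 -> gamma K != 0 ->
  let q := hermite_q K gamma in
  let N := n_nonreal (gamma_P K gamma) in
  (* (1) *)
  ((forall n, n_nonreal (q n) = 0%N) <-> N = 0%N) /\
  (N = 0%N -> forall n,
     simple_real_zeros (q n) /\ interlace (root (q n.+1)) (root (q n))) /\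
  (* (2) *)
  ((0 < N)%N ->
     exists n0 : nat,
       n_nonreal (q n0) = N /\
       (forall m, n_nonreal (q m) = N -> (n0 <= m)%N) /\
       forall n,
         ((n_real (q n) = (n - N)%N /\ n_nonreal (q n) = N) <-> (n0 <= n)%N) /\
         ((n0 <= n)%N ->
            simple_real_zeros (q n) /\ interlace (root (q n.+1)) (root (q n)))).
Proof.
move=> _ g0 _ q N.
have [n1 n1N] := @n_nonreal_ge R K gamma g0.
have eventually : exists n, n_nonreal (q n) == N.
  by exists n1; rewrite eqn_leq n_nonreal_q_le.
(* The count is nondecreasing and bounded by [N], so it stays at [N] once there. *)
have stable n m : n_nonreal (q n) = N -> (n <= m)%N -> n_nonreal (q m) = N.
  move=> nN nm; apply/eqP; rewrite eqn_leq n_nonreal_q_le //= -nN.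
  exact: n_nonreal_q_homo.
split; [split|split].
- by move=> h; apply/eqP; rewrite -leqn0 -(h n1).
- by move=> N0 n; apply/eqP; rewrite -leqn0 -N0 n_nonreal_q_le.
- move=> N0 n; have st m : (n <= m)%N -> n_nonreal (q m) = N.
    by move=> _; apply/eqP; rewrite N0 -leqn0 -N0 n_nonreal_q_le.
  by split; [exact: simple_q st _ (leqnn n) | exact: interlace_q st _ (leqnn n)].
move=> _; have [n0 /eqP n0N n0min] := ex_minnP eventually.
exists n0; split=> //; split=> [m /eqP/n0min //|n]; split.
  split=> [[_ /eqP/n0min]//|/(stable _ _ n0N) nN]; split=> //.
  (* The real and non-real counts add up to the degree n, so the truncated subtraction [n - N] is
     exact. *)
  have := n_realD (q_neq0 K g0 n); rewrite size_hermite_q //= => E.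
  by rewrite -[X in _ = (X - _)%N]E -nN addnK.
move=> n0n; have st m : (n <= m)%N -> n_nonreal (q m) = N.
  by move=> nm; apply: stable n0N (leq_trans n0n nm).
by split; [exact: simple_q st _ (leqnn n) | exact: interlace_q st _ (leqnn n)].
Qed.
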